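(* The satisfiability problem of $\mathrm{GRA}(p,I,\neg,J,\exists)$ is $\Pi_1^0$-complete.
   Context: AD-relations. $A^0=\{\epsilon\}$, with $\epsilon$ the empty tuple. A $k$-ary AD-relation over a set $A$ is a pair $(R,k)$ with $R\subseteq A^k$, $k\ge 0$; $t\in(R,k)$ means $t\in R$. Vocabularies contain only relation symbols (of any arity $k\ge 0$, countably infinitely many available for each arity). Models have nonempty (possibly infinite) domains; $A$ is the domain of $\mathfrak{A}$. Terms. $\mathrm{GRA}(p,I,\neg,J,\exists)$ is the set of terms built from relation symbols by the unary operators $p,I,\neg,\exists$ and the binary operator $J$. Each term $\mathcal{T}$ defines in each model $\mathfrak{A}$ an AD-relation $\mathcal{T}^{\mathfrak{A}}$ of arity $\mathit{ar}(\mathcal{T})$. Let $k=\mathit{ar}(\mathcal{T})$, $\ell=\mathit{ar}(\mathcal{S})$. - $R^{\mathfrak{A}}$ is the interpretation of $R$, paired with the arity of $R$. - If $k\ge2$: $(p\mathcal{T})^{\mathfrak{A}}=(\{(a_k,a_1,\dots,a_{k-1})\mid(a_1,\dots,a_k)\in\mathcal{T}^{\mathfrak{A}}\},k)$ and $(I\mathcal{T})^{\mathfrak{A}}=(\{(a_1,\dots,a_{k-1})\mid(a_1,\dots,a_k)\in\mathcal{T}^{\mathfrak{A}},\ a_{k-1}=a_k\},k-1)$; if $k\le1$ both equal $\mathcal{T}^{\mathfrak{A}}$. - $(\neg\mathcal{T})^{\mathfrak{A}}=(\{t\in A^k\mid t\notin\mathcal{T}^{\mathfrak{A}}\},k)$.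 - $(J(\mathcal{T},\mathcal{S}))^{\mathfrak{A}}=(\{(a_1,\dots,a_k,b_1,\dots,b_\ell)\mid(a_1,\dots,a_k)\in\mathcal{T}^{\mathfrak{A}},(b_1,\dots,b_\ell)\in\mathcal{S}^{\mathfrak{A}}\},k+\ell)$. - If $k\ge1$: $(\exists\mathcal{T})^{\mathfrak{A}}=(\{(a_1,\dots,a_{k-1})\mid(a_1,\dots,a_k)\in\mathcal{T}^{\mathfrak{A}}\text{ for some }a_k\in A\},k-1)$; if $k=0$: $(\exists\mathcal{T})^{\mathfrak{A}}=\mathcal{T}^{\mathfrak{A}}$. Satisfiability problem for a set $\mathcal{G}$ of terms: on input $\mathcal{T}\in\mathcal{G}$, answer yes iff there exists a model $\mathfrak{A}$ such that $\mathcal{T}^{\mathfrak{A}}$ is not the empty AD-relation $(\varnothing,\mathit{ar}(\mathcal{T}))$. *)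

(* Defs.v *)
From Stdlib Require Cantor.
From mathcomp Require Import all_boot.
From mathcomp Require Import classical_sets.

Set Implicit Arguments.
Unset Strict Implicit.
Unset Printing Implicit Defensive.

Local Open Scope classical_set_scope.

(* The arity is carried by the type, so the empty relations of two different
   arities are distinct objects; [0.-tuple A] has [[tuple]] as its only
   element, which plays the role of the empty tuple. *)
Definition adrel (A : Type) (k : nat) : Type := set (k.-tuple A).


Definition ad_p (A : Type) (k : nat) : adrel A k -> adrel A k :=
  match k with
  | k'.+2 => fun X =>
      [set u | exists (s : k'.+1.-tuple A) (a : A),
         X [tuple of rcons s a] /\ u = [tuple of a :: s]]
  | _ => fun X => X
  end.

Definition arI (k : nat) : nat := if k is k'.+2 then k'.+1 else k.

Definition ad_I (A : Type) (k : nat) : adrel A k -> adrel A (arI k) :=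
  match k with
  | k'.+2 => fun X =>
      [set s : k'.+1.-tuple A | exists a : A,
         X [tuple of rcons s a] /\ tnth s ord_max = a]
  | _ => fun X => X
  end.

Definition ad_neg (A : Type) (k : nat) (X : adrel A k) : adrel A k := [set t | ~ X t].

Definition ad_J (A : Type) (k l : nat) (X : adrel A k) (Y : adrel A l) :
    adrel A (k + l) :=
  [set u | exists (t : k.-tuple A) (s : l.-tuple A),
     [/\ X t, Y s & u = [tuple of t ++ s]]].

Definition ad_ex (A : Type) (k : nat) : adrel A k -> adrel A k.-1 :=
  match k with
  | k'.+1 => fun X =>
      [set s : k'.-tuple A | exists a : A, X [tuple of rcons s a]]
  | _ => fun X => X
  end.

(* [TRel k i] is the [i]-th relation symbol of arity [k]. *)
Inductive term : Type :=
  | TRel (k i : nat)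
  | TPerm (T : term)
  | TIdent (T : term)
  | TNeg (T : term)
  | TJoin (T U : term)
  | TExists (T : term).

Fixpoint ar (T : term) : nat :=
  match T with
  | TRel k _ => k
  | TPerm T => ar T
  | TIdent T => arI (ar T)
  | TNeg T => ar T
  | TJoin T U => ar T + ar U
  | TExists T => (ar T).-1
  end.

Unset Implicit Arguments.

(* Every relation symbol is interpreted; symbols outside of the vocabulary under
   consideration do not affect the value of a term. *)
Record model : Type := Model {
  dom : Type;
  dom_nonempty : inhabited dom;
  interp : forall k i : nat, adrel dom k
}.

Fixpoint denot (M : model) (T : term) : adrel (dom M) (ar T) :=
  match T return adrel (dom M) (ar T) with
  | TRel k i => interp M k i
  | TPerm T => ad_p (denot M T)
  | TIdent T => ad_I (denot M T)
  | TNeg T => ad_neg (denot M T)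
  | TJoin T U => ad_J (denot M T) (denot M U)
  | TExists T => ad_ex (denot M T)
  end.

Set Implicit Arguments.

Definition satisfiable (T : term) : Prop :=
  exists M : model, denot M T <> set0.

Definition pair_code (a b : nat) : nat := Cantor.to_nat (a, b).

Fixpoint term_code (T : term) : nat :=
  match T with
  | TRel k i => pair_code 0 (pair_code k i)
  | TPerm T => pair_code 1 (term_code T)
  | TIdent T => pair_code 2 (term_code T)
  | TNeg T => pair_code 3 (term_code T)
  | TJoin T U => pair_code 4 (pair_code (term_code T) (term_code U))
  | TExists T => pair_code 5 (term_code T)
  end.

Lemma pair_code_inj (a b c d : nat) :
  pair_code a b = pair_code c d -> a = c /\ b = d.
Proof. by move/(f_equal Cantor.of_nat); rewrite !Cantor.cancel_of_to => -[]. Qed.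

Lemma term_code_inj : injective term_code.
Proof.
elim=> [k i|T IH|T IH|T IH|T IHT U IHU|T IH] [k' i'|T'|T'|T'|T' U'|T'] /=
  /pair_code_inj[] // _.
- by case/pair_code_inj => -> ->.
- by move/IH => ->.
- by move/IH => ->.
- by move/IH => ->.
- by case/pair_code_inj => /IHT -> /IHU ->.
- by move/IH => ->.
Qed.

(* Total recursive functions: the least class containing the initial functions
   and closed under composition, primitive recursion and minimization of
   regular functions. In [recursive_mu] the regularity of [f] is witnessed by
   the totality of [h]. *)
Inductive recursive : forall n : nat, (n.-tuple nat -> nat) -> Prop :=
  | recursive_zero : recursive (fun _ : 0.-tuple nat => 0)
  | recursive_succ : recursive (fun v : 1.-tuple nat => (tnth v ord0).+1)
  | recursive_proj (n : nat) (i : 'I_n) :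
      recursive (fun v : n.-tuple nat => tnth v i)
  | recursive_comp (m n : nat) (f : m.-tuple nat -> nat)
      (g : 'I_m -> n.-tuple nat -> nat) :
      recursive f -> (forall i, recursive (g i)) ->
      recursive (fun v : n.-tuple nat => f [tuple g i v | i < m])
  | recursive_prec (n : nat) (f : n.-tuple nat -> nat)
      (g : n.+2.-tuple nat -> nat) (h : n.+1.-tuple nat -> nat) :
      recursive f -> recursive g ->
      (forall v : n.-tuple nat, h [tuple of 0 :: v] = f v) ->
      (forall (x : nat) (v : n.-tuple nat),
         h [tuple of x.+1 :: v] =
         g [tuple of x :: h [tuple of x :: v] :: v]) ->
      recursive h
  | recursive_mu (n : nat) (f : n.+1.-tuple nat -> nat)
      (h : n.-tuple nat -> nat) :
      recursive f ->
      (forall v : n.-tuple nat, f [tuple of h v :: v] = 0) ->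
      (forall (v : n.-tuple nat) (y : nat),
         y < h v -> f [tuple of y :: v] <> 0) ->
      recursive h.

Definition recursive_fun (f : nat -> nat) : Prop :=
  recursive (fun v : 1.-tuple nat => f (tnth v ord0)).

Definition recursive_rel (R : nat -> nat -> bool) : Prop :=
  recursive (fun v : 2.-tuple nat =>
               nat_of_bool (R (tnth v ord0) (tnth v ord_max))).

Definition Pi01 (P : set nat) : Prop :=
  exists2 R : nat -> nat -> bool, recursive_rel R &
    forall n : nat, P n <-> forall m : nat, R n m.

Definition many_one_reducible (P Q : set nat) : Prop :=
  exists2 f : nat -> nat, recursive_fun f & forall n : nat, P n <-> Q (f n).

Definition Pi01_complete (P : set nat) : Prop :=
  Pi01 P /\ forall Q : set nat, Pi01 Q -> many_one_reducible Q P.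

Definition sat_problem : set nat :=
  [set term_code T | T in [set T | satisfiable T]].

(* Main.v *)
(** The fragment has no equality symbol, so a term is satisfiable iff it has a
    model whose domain is the set of natural numbers, the witness of an
    existential subterm [u] at a tuple [s] being a number computed from [u] and
    [s].  Satisfiability thus becomes the consistency of an infinite recursive
    list of propositional constraints on truth values [V (u, s)], and by König's
    lemma this is the consistency of each of its finite parts.

    For hardness, the operators cannot permute coordinates freely, but on binary
    relations they yield relational composition, intersection and converse, and
    every recursive function has a Horn axiomatization in this calculus, over a
    domain of lists with head, tail, zero and successor relations.  The standard
    lists satisfy the axioms, and in every model the values of the function at
    the numerals are forced.  So "[R n m] holds for all [m]" reduces to the
    satisfiability of the axioms together with the emptiness of a composed
    relation that searches for an [m] at which [R n m] fails. *)

From Stdlib Require Cantor.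
From mathcomp Require Import all_boot.
From mathcomp Require Import boolp classical_sets.
Require Import Defs.

Set Implicit Arguments.
Unset Strict Implicit.
Unset Printing Implicit Defensive.

(** * Values of terms on sequences *)

(** Arities such as [ar T + ar U] agree with others only propositionally. Working with plain
    sequences avoids casts between tuple types, and membership still forces the right length. *)
Definition inrel (A : Type) (k : nat) (X : adrel A k) (s : seq A) : Prop :=
  exists2 t : k.-tuple A, tval t = s & X t.

Definition holds (M : model) (T : term) (s : seq (dom M)) : Prop :=
  inrel (denot M T) s.

Section InRel.
Variable A : Type.
Implicit Types s t : seq A.

Lemma inrel_size k (X : adrel A k) s : inrel X s -> size s = k.
Proof. by case=> t <- _; rewrite size_tuple. Qed.

Lemma inrelE k (X : adrel A k) (t : k.-tuple A) : inrel X t <-> X t.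
Proof. by split=> [[u /val_inj ->]|Xt] //; exists t. Qed.

Lemma inrel_p k (X : adrel A k) s :
  size s = k -> inrel (ad_p X) s <-> inrel X (rot 1 s).
Proof.
case: k X => [|[|k]] X sz.
- by case: s sz.
- by case: s sz => [|a []].
case: s sz => [//|a s] [sz]; rewrite rot1_cons.
have sz' : size s == k.+1 by rewrite sz.
rewrite -[rcons s a]/(tval [tuple of rcons (Tuple sz') a]) inrelE.
split=> [[t et [s' [b [Xb eu]]]]|Xa].
  move: et; rewrite eu /= => -[eb es].
  by congr (X _): Xb; apply: val_inj; rewrite /= eb es.
by exists [tuple of a :: Tuple sz'] => //; exists (Tuple sz'), a.
Qed.

Lemma inrel_I k (X : adrel A k) s a : 1 < k ->
  inrel (ad_I X) (rcons s a) <-> inrel X (rcons (rcons s a) a).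
Proof.
case: k X => [|[|k]] // X _; split.
  case=> t et [b [Xb eb]]; exists [tuple of rcons t b] => //=.
  rewrite et -eb (tnth_nth a) /= et nth_rcons.
  suff -> : k = size s by rewrite ltnn eqxx.
  by have := size_tuple t; rewrite et size_rcons => -[].
move=> Xa; have sz : size (rcons s a) == k.+1.
  by have := inrel_size Xa; rewrite !size_rcons => -[->].
exists (Tuple sz) => //; exists a; split; first exact/inrelE.
rewrite (tnth_nth a) /= nth_rcons.
by move: sz; rewrite size_rcons eqSS => /eqP ->; rewrite ltnn eqxx.
Qed.

Lemma inrel_I_small k (X : adrel A k) s :
  k <= 1 -> inrel (ad_I X) s <-> inrel X s.
Proof. by case: k X => [|[|k]]. Qed.

Lemma inrel_neg k (X : adrel A k) s :
  size s = k -> inrel (ad_neg X) s <-> ~ inrel X s.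
Proof. by move/eqP=> sz; rewrite -[s]/(tval (Tuple sz)) !inrelE. Qed.

Lemma inrel_J k l (X : adrel A k) (Y : adrel A l) s t :
  size s = k -> inrel (ad_J X Y) (s ++ t) <-> inrel X s /\ inrel Y t.
Proof.
move=> sz; split.
  case=> u eu [s' [t' [Xs Yt eu']]]; move: eu; rewrite eu' /= => e.
  have es : tval s' = s.
    by have := congr1 (take k) e; rewrite !take_size_cat ?size_tuple.
  have et : tval t' = t.
    by have := congr1 (drop k) e; rewrite !drop_size_cat ?size_tuple.
  by split; [rewrite -es|rewrite -et]; apply/inrelE.
by case=> -[s' <- Xs] [t' <- Yt]; exists [tuple of s' ++ t'] => //; exists s', t'.
Qed.

Lemma inrel_ex k (X : adrel A k) s :
  0 < k -> inrel (ad_ex X) s <-> exists a, inrel X (rcons s a).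
Proof.
case: k X => // k X _; split.
  by case=> t <- [a Xa]; exists a; exists [tuple of rcons t a].
case=> a Xa; have sz : size s == k.
  by have := inrel_size Xa; rewrite size_rcons => -[->].
by exists (Tuple sz) => //; exists a; apply/inrelE.
Qed.

Lemma inrel_ex0 k (X : adrel A k) s :
  k = 0 -> inrel (ad_ex X) s <-> inrel X s.
Proof. by case: k X. Qed.

End InRel.

Section Holds.
Variable M : model.
Implicit Types (T U : term) (s t : seq (dom M)).

Lemma holds_size T s : holds T s -> size s = ar T.
Proof. exact: inrel_size. Qed.

Lemma holds_perm T s : size s = ar T -> holds (TPerm T) s <-> holds T (rot 1 s).
Proof. exact: inrel_p. Qed.

Lemma holds_ident T s a : 1 < ar T ->
  holds (TIdent T) (rcons s a) <-> holds T (rcons (rcons s a) a).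
Proof. exact: inrel_I. Qed.

Lemma holds_ident_small T s : ar T <= 1 -> holds (TIdent T) s <-> holds T s.
Proof. exact: inrel_I_small. Qed.

Lemma holds_neg T s : size s = ar T -> holds (TNeg T) s <-> ~ holds T s.
Proof. exact: inrel_neg. Qed.

Lemma holds_join T U s t :
  size s = ar T -> holds (TJoin T U) (s ++ t) <-> holds T s /\ holds U t.
Proof. exact: inrel_J. Qed.

Lemma holds_ex T s : 0 < ar T ->
  holds (TExists T) s <-> exists a, holds T (rcons s a).
Proof. exact: inrel_ex. Qed.

Lemma holds_ex0 T s : ar T = 0 -> holds (TExists T) s <-> holds T s.
Proof. exact: inrel_ex0. Qed.

End Holds.

Lemma satisfiableP T :
  satisfiable T <-> exists (M : model) (s : seq (dom M)), holds T s.
Proof.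
split=> -[M].
  by move/eqP/set0P=> [t Tt]; exists M, t; apply/inrelE.
by case=> s [t _ Tt]; exists M; apply/eqP/set0P; exists t.
Qed.

(** * Recursive functions on coded data *)

Lemma recursive_ext n (f g : n.-tuple nat -> nat) :
  (forall v, f v = g v) -> recursive f -> recursive g.
Proof. by move=> /funext ->. Qed.

Definition recursive2 (F : nat -> nat -> nat) : Prop :=
  recursive (fun v : 2.-tuple nat => F (tnth v ord0) (tnth v ord_max)).

Lemma recursive_comp1 n (f : nat -> nat) (g : n.-tuple nat -> nat) :
  recursive_fun f -> recursive g -> recursive (fun v => f (g v)).
Proof.
move=> rf rg; apply: recursive_ext (recursive_comp rf (fun=> rg)) => v.
by rewrite tnth_mktuple.
Qed.

Lemma recursive_comp2 n F (g h : n.-tuple nat -> nat) :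
  recursive2 F -> recursive g -> recursive h ->
  recursive (fun v => F (g v) (h v)).
Proof.
move=> rF rg rh.
have rgh (i : 'I_2) : recursive (if i == ord0 then g else h) by case: ifP.
by apply: recursive_ext (recursive_comp rF rgh) => v; rewrite !tnth_mktuple.
Qed.

Lemma recursive_zeros n : recursive (fun _ : n.-tuple nat => 0).
Proof.
have noG (i : 'I_0) : recursive (fun _ : n.-tuple nat => 0) by case: i.
exact: recursive_comp recursive_zero noG.
Qed.

Lemma recursive_consts n c : recursive (fun _ : n.-tuple nat => c).
Proof.
elim: c => [|c IH]; first exact: recursive_zeros.
exact: (recursive_comp1 recursive_succ IH).
Qed.

(** Primitive recursion with one parameter, phrased through [iteri] so that loops can be written as
    ordinary functions. The three coordinates of the step are the index, the accumulator and the
    parameter. *)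
Lemma recursive_iteri (b : nat -> nat) (s : nat -> nat -> nat -> nat) :
  recursive_fun b ->
  recursive (fun v : 3.-tuple nat =>
               s (tnth v (inord 0)) (tnth v (inord 1)) (tnth v (inord 2))) ->
  recursive2 (fun x c => iteri x (fun i r => s i r c) (b c)).
Proof.
move=> rb rs; apply: (recursive_prec rb rs) => [v|x v].
  by rewrite !(tnth_nth 0).
by rewrite !(tnth_nth 0) /= !inordK.
Qed.

Lemma recursive2_swap F : recursive2 F -> recursive2 (fun x y => F y x).
Proof.
move=> rF; exact: recursive_comp2 rF (recursive_proj _) (recursive_proj _).
Qed.

Lemma recursive2_add : recursive2 addn.
Proof.
have := @recursive_iteri id (fun _ r _ => r.+1) (recursive_proj ord0)
  (recursive_comp1 recursive_succ (recursive_proj _)).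
by apply: recursive_ext => v; elim: (tnth v ord0) => //= n ->.
Qed.

Lemma recursive_pred : recursive_fun predn.
Proof.
(* The step forgets the accumulator and returns the loop index, so [n] rounds end with [n.-1]. *)
have r2 := @recursive_iteri (fun=> 0) (fun i _ _ => i) (recursive_zeros _)
  (recursive_proj _).
apply: recursive_ext (recursive_comp2 r2 (recursive_proj ord0) (recursive_proj ord0)).
by move=> v; case: (tnth v ord0).
Qed.

Lemma recursive2_sub : recursive2 subn.
Proof.
have r2 := @recursive_iteri id (fun _ r _ => r.-1) (recursive_proj ord0)
  (recursive_comp1 recursive_pred (recursive_proj _)).
apply: recursive_ext (recursive2_swap r2) => v.
by elim: (tnth v ord_max) => [|n /= ->]; rewrite ?subn0 ?subnS.
Qed.

(** The triangular numbers, written as in the definition of Cantor's pairing, so that [pair_codeE]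
    holds almost by computation. *)
Definition triangle (n : nat) : nat := iteri n (fun i r => i.+1 + r) 0.

Lemma recursive_triangle : recursive_fun triangle.
Proof.
have r2 := @recursive_iteri (fun=> 0) (fun i r _ => i.+1 + r) (recursive_zeros _)
  (recursive_comp2 recursive2_add
     (recursive_comp1 recursive_succ (recursive_proj _)) (recursive_proj _)).
exact: (recursive_comp2 r2 (recursive_proj ord0) (recursive_proj ord0)).
Qed.

Lemma pair_codeE a b : pair_code a b = b + triangle (b + a).
Proof.
by rewrite /pair_code /Cantor.to_nat -plusE; congr (_ + _).
Qed.

Lemma recursive2_pair : recursive2 pair_code.
Proof.
have rb := recursive_proj (@ord_max 1); have ra := recursive_proj (@ord0 1).
apply: recursive_ext (recursive_comp2 recursive2_add rb (recursive_comp1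
  recursive_triangle (recursive_comp2 recursive2_add rb ra))) => v.
by rewrite pair_codeE.
Qed.

Lemma leq_triangle m n : m <= n -> triangle m <= triangle n.
Proof.
move=> /subnK <-; elim: (n - m) => // k IH.
by rewrite addSn /triangle /= (leq_trans IH) // leq_addl.
Qed.

(* The antidiagonal containing the pair coded by [n]; it is the least [w] such
   that [n < triangle w.+1], hence recursive by minimization. *)
Definition diag (n : nat) : nat :=
  (Cantor.of_nat n).2 + (Cantor.of_nat n).1.

Lemma diagP n : n = (Cantor.of_nat n).2 + triangle (diag n).
Proof.
rewrite -pair_codeE /pair_code -[LHS]Cantor.cancel_to_of.
by case: (Cantor.of_nat n).
Qed.

Lemma recursive_diag : recursive_fun diag.
Proof.
have rf : recursive (fun v : 2.-tuple nat =>
    (tnth v ord_max).+1 - triangle (tnth v ord0).+1).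
  apply: (recursive_comp2 recursive2_sub).
    exact: (recursive_comp1 recursive_succ (recursive_proj _)).
  apply: (recursive_comp1 recursive_triangle).
  exact: (recursive_comp1 recursive_succ (recursive_proj _)).
apply: (recursive_mu rf) => [v|v y]; rewrite !(tnth_nth 0) /=;
  set n := nth _ _ _; have := diagP n => en.
  apply/eqP; rewrite -/(leq _ _) {1}en /triangle /= -/(triangle _) ltn_add2r.
  by rewrite ltnS leq_addr.
move=> /leq_triangle yd; apply/eqP; rewrite -/(leq _ _) -ltnNge ltnS.
by apply: leq_trans yd _; rewrite {2}en leq_addl.
Qed.

Lemma recursive_snd : recursive_fun (fun n => (Cantor.of_nat n).2).
Proof.
apply: recursive_ext (recursive_comp2 recursive2_sub (recursive_proj ord0)
  (recursive_comp1 recursive_triangle recursive_diag)) => v /=.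
by rewrite {1}(diagP (tnth _ _)) addnK.
Qed.

Lemma recursive_fst : recursive_fun (fun n => (Cantor.of_nat n).1).
Proof.
apply: recursive_ext (recursive_comp2 recursive2_sub recursive_diag
  recursive_snd) => v /=.
by rewrite /diag addnC addnK.
Qed.

(** * Computable functions between coded types *)

Structure codedType := CodedType { coded_sort :> Type; code : coded_sort -> nat }.
Arguments code {_}.

Definition code_pair (A B : codedType) (p : A * B) : nat :=
  pair_code (code p.1) (code p.2).
Definition code_seq : seq nat -> nat :=
  foldr (fun a n => (pair_code a n).+1) 0.

Canonical nat_codedType := CodedType (fun n : nat => n).
Canonical bool_codedType := CodedType nat_of_bool.
Canonical pair_codedType (A B : codedType) := CodedType (@code_pair A B).
Canonical seq_codedType := CodedType code_seq.

(** The recursive function [g] is constrained only on codes, so its values at other numbers are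
    free. *)
Definition computable {A B : codedType} (f : A -> B) :=
  exists2 g : nat -> nat, recursive_fun g & forall a, g (code a) = code (f a).

Lemma computable_recursive (f : nat -> nat) : computable f -> recursive_fun f.
Proof. by case=> g rg gf; apply: recursive_ext rg => v; apply: gf. Qed.

Lemma of_natK n : pair_code (Cantor.of_nat n).1 (Cantor.of_nat n).2 = n.
Proof.
by rewrite /pair_code -[RHS]Cantor.cancel_to_of; case: (Cantor.of_nat n).
Qed.

Lemma pair_codeK a b : Cantor.of_nat (pair_code a b) = (a, b).
Proof. exact: Cantor.cancel_of_to. Qed.

Section Computable.
Variables A B C D : codedType.

(** A function that merely views the same number as an object of another type is realized by the
    identity. This covers [code], [Cantor.of_nat] and [decode]. *)
Lemma computable_recoded (f : A -> B) :
  (forall a, code (f a) = code a) -> computable f.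
Proof. by move=> fE; exists id => [|a]; [exact: recursive_proj|rewrite fE]. Qed.

Lemma computable_ext (f g : A -> B) :
  (forall a, f a = g a) -> computable f -> computable g.
Proof. by move=> /funext ->. Qed.

Lemma computable_comp (f : A -> B) (g : B -> C) :
  computable g -> computable f -> computable (fun a => g (f a)).
Proof.
move=> [g' rg gE] [f' rf fE]; exists (fun n => g' (f' n)).
  exact: recursive_comp1 rg rf.
by move=> a; rewrite fE gE.
Qed.

Lemma computable_fun2 F (f : A -> nat) (g : A -> nat) :
  recursive2 F -> computable f -> computable g ->
  computable (fun a => F (f a) (g a)).
Proof.
move=> rF [f' rf fE] [g' rg gE]; exists (fun n => F (f' n) (g' n)).
  exact: recursive_comp2 rF rf rg.
by move=> a; rewrite fE gE.
Qed.

Lemma computable_const (b : B) : computable (fun _ : A => b).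
Proof. by exists (fun=> code b) => //; apply: recursive_consts. Qed.

Lemma computable_pair (f : A -> B) (g : A -> C) :
  computable f -> computable g -> computable (fun a => (f a, g a)).
Proof.
move=> [f' rf fE] [g' rg gE]; exists (fun n => pair_code (f' n) (g' n)).
  exact: recursive_comp2 recursive2_pair rf rg.
by move=> a; rewrite fE gE.
Qed.

Lemma computable_fst (f : A -> B * C) : computable f -> computable (fun a => (f a).1).
Proof.
move=> [f' rf fE]; exists (fun n => (Cantor.of_nat (f' n)).1).
  exact: recursive_comp1 recursive_fst rf.
by move=> a; rewrite fE pair_codeK.
Qed.

Lemma computable_snd (f : A -> B * C) : computable f -> computable (fun a => (f a).2).
Proof.
move=> [f' rf fE]; exists (fun n => (Cantor.of_nat (f' n)).2).
  exact: recursive_comp1 recursive_snd rf.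
by move=> a; rewrite fE pair_codeK.
Qed.

End Computable.

Lemma computable_iteri (C B : codedType)
    (k : C -> nat) (s : C -> nat -> B -> B) (b : C -> B) :
  computable k -> computable (fun p : C * (nat * B) => s p.1 p.2.1 p.2.2) ->
  computable b -> computable (fun c => iteri (k c) (s c) (b c)).
Proof.
move=> [k' rk kE] [s' rs sE] [b' rb bE].
exists (fun n =>
  iteri (k' n) (fun i r => s' (pair_code n (pair_code i r))) (b' n)).
  have r3 i : recursive (fun v : 3.-tuple nat => tnth v i) by apply: recursive_proj.
  have r2 := @recursive_iteri b'
    (fun i r n => s' (pair_code n (pair_code i r))) rb
    (recursive_comp1 rs (recursive_comp2 recursive2_pair (r3 _)
       (recursive_comp2 recursive2_pair (r3 _) (r3 _)))).
  exact: (recursive_comp2 r2 rk (recursive_proj ord0)).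
move=> c; rewrite kE bE; elim: (k c) => //= i ->.
exact: (sE (c, (i, iteri i (s c) (b c)))).
Qed.

Lemma computable_id (A : codedType) : computable (fun a : A => a).
Proof. exact: computable_recoded. Qed.

Section ComputableOps.
Variable C : codedType.

Lemma computable_succ (f : C -> nat) : computable f -> computable (fun c => (f c).+1).
Proof.
by move=> [f' rf fE]; exists (fun n => (f' n).+1) => [|c]; rewrite ?fE //;
  apply: (recursive_comp1 recursive_succ rf).
Qed.

Lemma computable_pred (f : C -> nat) : computable f -> computable (fun c => (f c).-1).
Proof.
by move=> [f' rf fE]; exists (fun n => (f' n).-1) => [|c]; rewrite ?fE //;
  apply: (recursive_comp1 recursive_pred rf).
Qed.

Lemma computable_code (B : codedType) (f : C -> B) :
  computable f -> computable (fun c => code (f c)).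
Proof. by apply: computable_comp; apply: computable_recoded. Qed.

Lemma computable_of_nat (f : C -> nat) :
  computable f -> computable (fun c => Cantor.of_nat (f c)).
Proof. by apply: computable_comp; apply: computable_recoded => n; apply: of_natK. Qed.

Lemma computable_if (B : codedType) (b : C -> bool) (f g : C -> B) :
  computable b -> computable f -> computable g ->
  computable (fun c => if b c then f c else g c).
Proof.
(* A conditional is a loop that runs once or not at all. *)
move=> rb rf rg; suff: computable (fun c => iteri (code (b c)) (fun _ _ => f c) (g c)).
  by apply: computable_ext => c; case: (b c).
apply: computable_iteri => //.
by apply: (computable_comp rf); apply: computable_fst; apply: computable_id.
Qed.

Lemma computable_iszero (f : C -> nat) : computable f -> computable (fun c => f c == 0).
Proof.
move=> rf; suff: computable (fun c => iteri (f c) (fun _ _ => false) true).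
  by apply: computable_ext => c; case: (f c).
by apply: computable_iteri => //; apply: computable_const.
Qed.

Lemma computable_add (f g : C -> nat) :
  computable f -> computable g -> computable (fun c => f c + g c).
Proof. exact: computable_fun2 recursive2_add. Qed.

Lemma computable_sub (f g : C -> nat) :
  computable f -> computable g -> computable (fun c => f c - g c).
Proof. exact: computable_fun2 recursive2_sub. Qed.

Lemma computable_pair_code (f g : C -> nat) :
  computable f -> computable g -> computable (fun c => pair_code (f c) (g c)).
Proof. exact: computable_fun2 recursive2_pair. Qed.

Lemma computable_leq (f g : C -> nat) :
  computable f -> computable g -> computable (fun c => f c <= g c).
Proof. by move=> rf rg; apply: computable_iszero; apply: computable_sub. Qed.

Lemma computable_and (f g : C -> bool) :
  computable f -> computable g -> computable (fun c => f c && g c).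
Proof. by move=> rf rg; apply: computable_if => //; apply: computable_const. Qed.

Lemma computable_or (f g : C -> bool) :
  computable f -> computable g -> computable (fun c => f c || g c).
Proof. by move=> rf rg; apply: computable_if => //; apply: computable_const. Qed.

Lemma computable_imp (f g : C -> bool) :
  computable f -> computable g -> computable (fun c => f c ==> g c).
Proof. by move=> rf rg; apply: computable_if => //; apply: computable_const. Qed.

Lemma computable_neg (f : C -> bool) : computable f -> computable (fun c => ~~ f c).
Proof. by move=> rf; apply: computable_if => //; apply: computable_const. Qed.

Lemma computable_eqn (f g : C -> nat) :
  computable f -> computable g -> computable (fun c => f c == g c).
Proof.
move=> rf rg; suff: computable (fun c => (f c <= g c) && (g c <= f c)).
  by apply: computable_ext => c; rewrite eqn_leq.
by apply: computable_and; apply: computable_leq.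
Qed.

Lemma computable_eqb (f g : C -> bool) :
  computable f -> computable g -> computable (fun c => f c == g c).
Proof.
move=> rf rg; suff: computable (fun c => code (f c) == code (g c)).
  by apply: computable_ext => c; case: (f c); case: (g c).
by apply: computable_eqn; apply: computable_code.
Qed.

End ComputableOps.

Lemma computable_all_iota (C : codedType) (k : C -> nat) (P : C -> nat -> bool) :
  computable k -> computable (fun p : C * nat => P p.1 p.2) ->
  computable (fun c => all (P c) (iota 0 (k c))).
Proof.
move=> rk rP; suff: computable (fun c => iteri (k c) (fun i r => r && P c i) true).
  apply: computable_ext => c; elim: (k c) => // n IH.
  by rewrite -addn1 iotaD all_cat addn1 /= IH andbT.
apply: computable_iteri => //; last exact: computable_const.
apply: computable_and.
  by apply: computable_snd; apply: computable_snd; apply: computable_id.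
apply: (computable_comp (f := fun p : C * (nat * bool) => (p.1, p.2.1)) rP).
apply: computable_pair.
  by apply: computable_fst; apply: computable_id.
by apply: computable_fst; apply: computable_snd; apply: computable_id.
Qed.

Lemma computable_has_iota (C : codedType) (k : C -> nat) (P : C -> nat -> bool) :
  computable k -> computable (fun p : C * nat => P p.1 p.2) ->
  computable (fun c => has (P c) (iota 0 (k c))).
Proof.
move=> rk rP.
suff: computable (fun c => ~~ all (fun i => ~~ P c i) (iota 0 (k c))).
  by apply: computable_ext => c; rewrite -has_predC;
     apply: eq_has => i /=; rewrite negbK.
by apply/computable_neg/computable_all_iota => //; apply: computable_neg.
Qed.

Lemma computable_cons (C : codedType) (f : C -> nat) (g : C -> seq nat) :
  computable f -> computable g -> computable (fun c => f c :: g c).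
Proof.
move=> rf rg; have [h rh hE] : computable (fun c => (pair_code (f c) (code (g c))).+1).
  by apply/computable_succ/computable_pair_code => //; apply: computable_code.
by exists h.
Qed.

Lemma code_seq_inj : injective (code : seq nat -> nat).
Proof.
elim=> [|a s IH] [|b t] // [] /pair_code_inj[-> /IH ->] //.
Qed.

Lemma computable_head : computable (head 0).
Proof.
have [g rg gE] : computable (fun n : nat => (Cantor.of_nat n.-1).1).
  by apply/computable_fst/computable_of_nat/computable_pred/computable_id.
by exists g => // -[|a s]; rewrite gE //= /code /= pair_codeK.
Qed.

Lemma computable_behead : computable (@behead nat).
Proof.
have [g rg gE] : computable (fun n : nat => (Cantor.of_nat n.-1).2).
  by apply/computable_snd/computable_of_nat/computable_pred/computable_id.
by exists g => // -[|a s]; rewrite gE //= /code /= pair_codeK.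
Qed.

Lemma leq_pair_code a b : (a <= pair_code a b) && (b <= pair_code a b).
Proof.
rewrite pair_codeE leq_addr andbT.
have le n : n <= triangle n by elim: n => // n IH; rewrite /triangle /= leq_addr.
apply: leq_trans (le _) _; apply: leq_trans (leq_addl _ _).
by apply: leq_triangle; rewrite leq_addl.
Qed.

Lemma size_leq_code (s : seq nat) : size s <= code s.
Proof.
elim: s => // a s IH; rewrite /code /= ltnS (leq_trans IH) //.
by have /andP[] := leq_pair_code a (code s).
Qed.

Lemma computable_eqseq (C : codedType) (f g : C -> seq nat) :
  computable f -> computable g -> computable (fun c => f c == g c).
Proof.
move=> rf rg; suff: computable (fun c => code (f c) == code (g c)).
  by apply: computable_ext => c; apply/eqP/eqP=> [/code_seq_inj|->].
by apply: computable_eqn; apply: computable_code.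
Qed.

Lemma computable_foldl (C B : codedType) (f : C -> B -> nat -> B) (b : C -> B)
    (l : C -> seq nat) :
  computable (fun p : C * (B * nat) => f p.1 p.2.1 p.2.2) ->
  computable b -> computable l -> computable (fun c => foldl (f c) (b c) (l c)).
Proof.
(* The state holds the accumulator and the unread entries. The loop runs [code (l c)] times, which
   is at least the length of the list, and idles once the list is exhausted. *)
move=> rf rb rl; pose step c (st : B * seq nat) :=
  if st.2 == [::] then st else (f c st.1 (head 0 st.2), behead st.2).
suff: computable (fun c => (iteri (code (l c)) (fun _ => step c) (b c, l c)).1).
  apply: computable_ext => c.
  have iteriS n st : iteri n.+1 (fun _ => step c) st =
      iteri n (fun _ => step c) (step c st) by elim: n => //= n ->.
  have := size_leq_code (l c); move: (code _) (b c) => n.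
  elim: (l c) n => [|a s IH] n b0 /= sz.
    suff -> : iteri n (fun _ => step c) (b0, [::]) = (b0, [::]) by [].
    by elim: n sz => //= n ->.
  by case: n sz => // n; rewrite ltnS => /IH {}IH; rewrite iteriS -IH.
have r2 (X Y Z W : codedType) :
    computable (fun p : X * (Y * (Z * W)) => p.2.2.2).
  by do 3 apply: computable_snd; apply: computable_id.
apply/computable_fst/computable_iteri; first exact: computable_code.
  apply: computable_if.
  - by apply: computable_eqseq; [apply: r2|apply: computable_const].
  - by do 2 apply: computable_snd; apply: computable_id.
  - apply: computable_pair.
      2: by apply: (computable_comp computable_behead); apply: r2.
    apply: (computable_comp (f := fun p : C * (nat * (B * seq nat)) =>
      (p.1, (p.2.2.1, head 0 p.2.2.2))) rf); apply: computable_pair.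
      by apply/computable_fst/computable_id.
    apply: computable_pair; last by apply: (computable_comp computable_head); apply: r2.
    by apply/computable_fst/computable_snd/computable_snd/computable_id.
exact: computable_pair.
Qed.

(** [computable1] applies the closure lemma of the outermost operation; [computable_user] is a hook,
    redefined once further operations are available. *)
Ltac computable_user := fail.
Ltac computable1 :=
  lazymatch goal with
  | |- computable (fun c => c) => apply: computable_id
  | |- computable (fun _ => ?b) => apply: computable_const
  | |- computable (fun c => (@?f c, @?g c)) => apply: (@computable_pair _ _ _ f g)
  | |- computable (fun c => (@?f c).1) => apply: (@computable_fst _ _ _ f)
  | |- computable (fun c => (@?f c).2) => apply: (@computable_snd _ _ _ f)
  | |- computable (fun c => S (@?f c)) => apply: (@computable_succ _ f)
  | |- computable (fun c => predn (@?f c)) => apply: (@computable_pred _ f)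
  | |- computable (fun c => Cantor.of_nat (@?f c)) => apply: (@computable_of_nat _ f)
  | |- computable (fun c => pair_code (@?f c) (@?g c)) =>
      apply: (@computable_pair_code _ f g)
  | |- computable (fun c => code (@?f c)) => apply: (@computable_code _ _ f)
  | |- computable (fun c => addn (@?f c) (@?g c)) => apply: (@computable_add _ f g)
  | |- computable (fun c => subn (@?f c) (@?g c)) => apply: (@computable_sub _ f g)
  | |- computable (fun c => leq (@?f c) (@?g c)) => apply: (@computable_leq _ f g)
  | |- computable (fun c => andb (@?f c) (@?g c)) => apply: (@computable_and _ f g)
  | |- computable (fun c => orb (@?f c) (@?g c)) => apply: (@computable_or _ f g)
  | |- computable (fun c => implb (@?f c) (@?g c)) => apply: (@computable_imp _ f g)
  | |- computable (fun c => negb (@?f c)) => apply: (@computable_neg _ f)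
  | |- computable (fun c => @eq_op _ (@?f c) (@?g c)) =>
      first [apply: (@computable_eqn _ f g) | apply: (@computable_eqb _ f g)
            | apply: (@computable_eqseq _ f g)]
  | |- computable (fun c => @cons _ (@?f c) (@?g c)) => apply: (@computable_cons _ f g)
  | |- computable (fun c => iteri (@?k c) _ _) => apply: (@computable_iteri _ _ k)
  | |- computable (fun c => head 0 (@?f c)) => apply: (computable_comp computable_head)
  | |- computable (fun c => behead (@?f c)) => apply: (computable_comp computable_behead)
  | |- computable (fun c => all _ (iota 0 (@?f c))) => apply: (@computable_all_iota _ f)
  | |- computable (fun c => has _ (iota 0 (@?f c))) => apply: (@computable_has_iota _ f)
  | |- computable (fun c => foldl _ _ _) => apply: computable_foldl
  | |- computable (fun c => if _ then _ else _) => apply: computable_if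
  | |- _ => computable_user
  end.
Ltac computable_tac := repeat (cbv beta; first [assumption | computable1]).

Lemma computable_size (C : codedType) (f : C -> seq nat) :
  computable f -> computable (fun c => size (f c)).
Proof.
move=> rf; have: computable (fun c => foldl (fun n _ => n.+1) 0 (f c)).
  by computable_tac.
apply: computable_ext => c; rewrite -[RHS]add0n; move: (f c) 0.
by elim=> [|a s IH] n /=; rewrite ?addn0 // IH addSnnS.
Qed.

Lemma computable_catrev (C : codedType) (f g : C -> seq nat) :
  computable f -> computable g -> computable (fun c => catrev (f c) (g c)).
Proof.
move=> rf rg; have: computable (fun c => foldl (fun s a => a :: s) (g c) (f c)).
  by computable_tac.
by apply: computable_ext => c; elim: (f c) (g c) => /=.
Qed.

Lemma computable_rev (C : codedType) (f : C -> seq nat) :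
  computable f -> computable (fun c => rev (f c)).
Proof. by move=> rf; apply: computable_catrev => //; apply: computable_const. Qed.

Lemma computable_cat (C : codedType) (f g : C -> seq nat) :
  computable f -> computable g -> computable (fun c => f c ++ g c).
Proof.
move=> rf rg; apply: (@computable_ext _ _ (fun c => catrev (rev (f c)) (g c))).
  by move=> c; rewrite catrevE revK.
by apply: computable_catrev => //; apply: computable_rev.
Qed.

Lemma computable_rcons (C : codedType) (f : C -> seq nat) (g : C -> nat) :
  computable f -> computable g -> computable (fun c => rcons (f c) (g c)).
Proof.
move=> rf rg; apply: (@computable_ext _ _ (fun c => f c ++ [:: g c])).
  by move=> c; rewrite cats1.
by apply: computable_cat; computable_tac.
Qed.

Lemma computable_last (C : codedType) (f : C -> seq nat) :
  computable f -> computable (fun c => last 0 (f c)).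
Proof.
move=> rf; apply: (@computable_ext _ _ (fun c => head 0 (rev (f c)))).
  by move=> c; case/lastP: (f c) => // s a; rewrite rev_rcons last_rcons.
by computable_tac; apply: computable_rev.
Qed.

Lemma computable_rot1 (C : codedType) (f : C -> seq nat) :
  computable f -> computable (fun c => rot 1 (f c)).
Proof.
move=> rf; apply: (@computable_ext _ _ (fun c =>
    if f c == [::] then [::] else rcons (behead (f c)) (head 0 (f c)))).
  by move=> c; case: (f c) => // a s; rewrite rot1_cons.
by computable_tac; apply: computable_rcons; computable_tac.
Qed.

Lemma computable_nth (C : codedType) (f : C -> seq nat) (g : C -> nat) :
  computable f -> computable g -> computable (fun c => nth 0 (f c) (g c)).
Proof.
move=> rf rg; apply: (@computable_ext _ _ (fun c =>
    head 0 (iteri (g c) (fun _ s => behead s) (f c)))); last by computable_tac.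
move=> c; rewrite -nth0; move: (f c) (g c) => s n.
suff H k : nth 0 (iteri n (fun _ s => behead s) s) k = nth 0 s (n + k).
  by rewrite H addn0.
by elim: n k => //= n IH k; rewrite nth_behead IH addSnnS.
Qed.

(** Numbers below [2 ^ m] serve as the valuations of [m] propositional variables, through their
    binary digits. *)
Definition bit (n i : nat) : bool := odd (iter i half n).

Lemma computable_odd (C : codedType) (f : C -> nat) :
  computable f -> computable (fun c => odd (f c)).
Proof.
move=> rf; apply: (@computable_ext _ _ (fun c =>
    iteri (f c) (fun _ b => ~~ b) false)); last by computable_tac.
by move=> c; elim: (f c) => //= n ->.
Qed.

Lemma computable_half (C : codedType) (f : C -> nat) :
  computable f -> computable (fun c => (f c)./2).
Proof.
move=> rf; apply: (@computable_ext _ _ (fun c =>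
    iteri (f c) (fun i r => if odd i then r.+1 else r) 0)).
  move=> c; elim: (f c) => //= n ->; rewrite uphalf_half.
  by case: odd.
by computable_tac; apply: computable_odd; computable_tac.
Qed.

Lemma computable_bit (C : codedType) (f g : C -> nat) :
  computable f -> computable g -> computable (fun c => bit (f c) (g c)).
Proof.
move=> rf rg; apply: computable_odd.
apply: (@computable_ext _ _ (fun c => iteri (g c) (fun _ => half) (f c))).
  by move=> c; elim: (g c) => //= n ->.
by computable_tac; apply: computable_half; computable_tac.
Qed.

Lemma computable_exp2 (C : codedType) (f : C -> nat) :
  computable f -> computable (fun c => 2 ^ f c).
Proof.
move=> rf; apply: (@computable_ext _ _ (fun c =>
    iteri (f c) (fun _ r => r + r) 1)); last by computable_tac.
by move=> c; elim: (f c) => //= n ->; rewrite expnS mul2n addnn.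
Qed.

(** * Recursive enumeration of unsatisfiability *)

Lemma mem_leq_code (s : seq nat) a : a \in s -> a < code s.
Proof.
elim: s => // b s IH; rewrite inE /code /= ltnS.
have /andP[le1 le2] := leq_pair_code b (code s).
by case/orP=> [/eqP ->|/IH/ltnW/leq_trans]; [|apply].
Qed.

Fixpoint decode_seq_rec (fuel n : nat) : seq nat :=
  if fuel is f.+1 then
    if n is m.+1 then
      (Cantor.of_nat m).1 :: decode_seq_rec f (Cantor.of_nat m).2
    else [::]
  else [::].

(** The coding of pairs [(u, s)] is a bijection onto [nat], so propositional variables can be
    identified with numbers. The code of a list bounds its length, hence is enough fuel. *)
Definition decode (x : nat) : nat * seq nat :=
  ((Cantor.of_nat x).1, decode_seq_rec (Cantor.of_nat x).2 (Cantor.of_nat x).2).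

Lemma code_decode_seq f n : n <= f -> code (decode_seq_rec f n) = n.
Proof.
elim: f n => [|f IH] [|n] //=; rewrite ltnS => le.
rewrite /code /= -/(code_seq _) -/(code (_ : seq nat)) IH ?of_natK //.
apply: leq_trans le; rewrite -{2}(of_natK n).
by case/andP: (leq_pair_code (Cantor.of_nat n).1 (Cantor.of_nat n).2).
Qed.

Lemma code_decode x : code (decode x) = x.
Proof. by rewrite /code /= /code_pair code_decode_seq //= of_natK. Qed.

Lemma decode_code p : decode (code p) = p.
Proof.
have := code_decode (code p); case: (decode _) => u s; case: p => u' s'.
by move/pair_code_inj => [/= -> /code_seq_inj ->].
Qed.

Lemma computable_decode (C : codedType) (f : C -> nat) :
  computable f -> computable (fun c => decode (f c)).
Proof. by apply: computable_comp; apply: computable_recoded; apply: code_decode. Qed.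

(* Course-of-values recursion: [tb] lists the values at [i - 1, ..., 0], so that
   the value at [j < i] has index [i - j.+1].  The value is [0] if [i] is not the
   code of a term, and the successor of the arity otherwise. *)
Definition arity_step (i : nat) (tb : seq nat) : nat :=
  let r := (Cantor.of_nat i).2 in
  let look j := nth 0 tb (i - j.+1) in
  let tag := (Cantor.of_nat i).1 in
  if tag == 0 then (Cantor.of_nat r).1.+1
  else if (tag == 1) || (tag == 3) then look r
  else if tag == 2 then if look r <= 2 then look r else (look r).-1
  else if tag == 4 then
    if (look (Cantor.of_nat r).1 == 0) || (look (Cantor.of_nat r).2 == 0) then 0
    else (look (Cantor.of_nat r).1 + look (Cantor.of_nat r).2).-1
  else if tag == 5 then if look r <= 1 then look r else (look r).-1
  else 0.

Definition arity_table (n : nat) : seq nat :=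
  iteri n (fun i tb => arity_step i tb :: tb) [::].

Definition arity_code (n : nat) : nat := head 0 (arity_table n.+1).

Lemma computable_arity_code (C : codedType) (f : C -> nat) :
  computable f -> computable (fun c => arity_code (f c)).
Proof.
move=> rf; rewrite /arity_code /arity_table /arity_step.
by computable_tac; apply: computable_nth; computable_tac.
Qed.

Lemma nth_arity_table n j : j < n -> nth 0 (arity_table n) (n - j.+1) = arity_code j.
Proof.
elim: n => // n IH; rewrite ltnS subSS leq_eqVlt => /orP[/eqP ->|lt].
  by rewrite subnn.
by rewrite /arity_table /= -/(arity_table n) -subnSK //= IH.
Qed.

Lemma pair_code_gt a b : 0 < a -> b < pair_code a b.
Proof.
move=> a0; rewrite pair_codeE -{1}[b]addn0 ltn_add2l.
by rewrite -(prednK a0) addnS.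
Qed.

Lemma arity_term T : arity_code (term_code T) = (ar T).+1.
Proof.
have lt_code t r j : 0 < t -> j <= r -> j < pair_code t r.
  by move=> t0 jr; apply: leq_ltn_trans (pair_code_gt r t0).
elim: T => [k i|T IH|T IH|T IH|T IHT U IHU|T IH];
  rewrite /arity_code /= /arity_step /= !pair_codeK /= ?pair_codeK //.
- by rewrite nth_arity_table ?lt_code.
- rewrite nth_arity_table ?lt_code // IH /arI.
  by case: (ar T) => [|[|k]].
- by rewrite nth_arity_table ?lt_code.
- have /andP[le1 le2] := leq_pair_code (term_code T) (term_code U).
  by rewrite !nth_arity_table ?lt_code // IHT IHU /= addnS.
- rewrite nth_arity_table ?lt_code // IH.
  by case: (ar T).
Qed.

(** With [arity_term], this makes a nonzero [arity_code] a decision procedure for being the code of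
    a term. *)
Lemma arity_code_gt0 n : 0 < arity_code n -> exists T, term_code T = n.
Proof.
elim/ltn_ind: n => n IH; rewrite /arity_code /= /arity_step.
have := of_natK n; move: (Cantor.of_nat n).1 (Cantor.of_nat n).2 => t r en.
(* The strict decrease fails for the tag [0], since [pair_code 0 0] is [0]; that tag marks a
   relation symbol, where no recursion takes place. *)
have lt0 : 0 < t -> r < n by move=> t0; rewrite -en pair_code_gt.
rewrite -[in X in _ -> X]en; case: (eqVneq t 0) => [-> _|t0].
  exists (TRel (Cantor.of_nat r).1 (Cantor.of_nat r).2).
  by rewrite /= of_natK.
have rn : r < n by apply: lt0; rewrite lt0n.
have [r1 r2] : (Cantor.of_nat r).1 < n /\ (Cantor.of_nat r).2 < n.
  have := leq_pair_code (Cantor.of_nat r).1 (Cantor.of_nat r).2.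
  by rewrite of_natK => /andP[l1 l2]; split; apply: leq_ltn_trans rn.
rewrite !nth_arity_table //.
case: (eqVneq t 1) => [-> /= /(IH _ rn)[T <-]|t1]; first by exists (TPerm T).
case: (eqVneq t 3) => [-> /= /(IH _ rn)[T <-]|t3]; first by exists (TNeg T).
case: (eqVneq t 2) => [-> /=|t2].
  case: ifP => [_ /(IH _ rn)[T <-]|]; first by exists (TIdent T).
  move=> h _; case: (IH _ rn) => [|T <-]; last by exists (TIdent T).
  by case: (arity_code r) h.
case: (eqVneq t 4) => [-> /=|t4].
  case: ifP => // /norP[]; rewrite -!lt0n => /(IH _ r1)[T eT] /(IH _ r2)[U eU] _.
  by exists (TJoin T U); rewrite /= eT eU of_natK.
case: (eqVneq t 5) => [-> /=|//].
case: ifP => [_ /(IH _ rn)[T <-]|]; first by exists (TExists T).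
move=> h _; case: (IH _ rn) => [|T <-]; last by exists (TExists T).
by case: (arity_code r) h.
Qed.
(* Even numbers name the entries of the satisfying tuple, and the odd number
   [2 * code (u, s) + 1] is the witness of the existential term coded by [u] at
   the tuple [s]; it is larger than all entries of [s]. *)
Definition witness (p : nat * seq nat) : nat := (code p + code p).+1.

Definition consts (k : nat) : seq nat := [seq i + i | i <- iota 0 k].

(* [a], [b], [c] are the truth values assigned to [x], [y], [z], where [(u, s)]
   stands for "the term coded by [u] holds at the tuple [s]". *)
Definition constraint (x y z : nat * seq nat) (a b c : bool) : bool :=
  (arity_code x.1 == (size x.2).+1) ==>
  [&& (x.1 == pair_code 1 y.1) && (rot 1 x.2 == y.2) ==> (a == b),
      (x.1 == pair_code 2 y.1) &&
        (y.2 == (if arity_code y.1 <= 2 then x.2 else rcons x.2 (last 0 x.2)))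
        ==> (a == b),
      (x.1 == pair_code 3 y.1) && (y.2 == x.2) ==> (a == ~~ b),
      [&& x.1 == pair_code 4 (pair_code y.1 z.1),
          arity_code y.1 == (size y.2).+1 & x.2 == y.2 ++ z.2]
        ==> (a == b && c),
      [&& x.1 == pair_code 5 y.1, arity_code y.1 <= 1 & y.2 == x.2]
        ==> (a == b),
      [&& x.1 == pair_code 5 y.1, 1 < arity_code y.1
        & y.2 == rcons x.2 (witness x)] && a ==> b
    & [&& x.1 == pair_code 5 y.1, 1 < arity_code y.1
        & y.2 == rcons x.2 (last 0 y.2)] && b ==> a].

Definition start (n : nat) : nat := code (n, consts (arity_code n).-1).

Definition coherent (n m : nat) (V : nat -> bool) : bool :=
  all (fun x => all (fun y => all (fun z =>
    constraint (decode x) (decode y) (decode z) (V x) (V y) (V z))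
    (iota 0 m)) (iota 0 m)) (iota 0 m)
  && ((start n < m) ==> V (start n)).

(** Consistency of the [m]-th finite part, which involves only the variables below [m], by
    exhausting the valuations. Numbers that code no term are rejected at once. *)
Definition sat_check (n m : nat) : bool :=
  (0 < arity_code n) && has (fun w => coherent n m (bit w)) (iota 0 (2 ^ m)).

Lemma computable_consts (C : codedType) (f : C -> nat) :
  computable f -> computable (fun c => consts (f c)).
Proof.
move=> rf; apply: (@computable_ext _ _ (fun c =>
    iteri (f c) (fun i s => rcons s (i + i)) [::])).
  move=> c; elim: (f c) => // n IH.
  by rewrite /consts -addn1 iotaD map_cat addn1 /= IH cats1.
by computable_tac; apply: computable_rcons; computable_tac.
Qed.

Ltac computable_user ::= lazymatch goal with
  | |- computable (fun c => arity_code (@?f c)) => apply: (@computable_arity_code _ f)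
  | |- computable (fun c => decode (@?f c)) => apply: (@computable_decode _ f)
  | |- computable (fun c => bit (@?f c) (@?g c)) => apply: (@computable_bit _ f g)
  | |- computable (fun c => consts (@?f c)) => apply: (@computable_consts _ f)
  | |- computable (fun c => size (@?f c)) => apply: (@computable_size _ f)
  | |- computable (fun c => rot 1 (@?f c)) => apply: (@computable_rot1 _ f)
  | |- computable (fun c => last 0 (@?f c)) => apply: (@computable_last _ f)
  | |- computable (fun c => rcons (@?f c) (@?g c)) => apply: (@computable_rcons _ f g)
  | |- computable (fun c => cat (@?f c) (@?g c)) => apply: (@computable_cat _ f g)
  | |- computable (fun c => expn 2 (@?f c)) => apply: (@computable_exp2 _ f)
  end.

Lemma computable_constraint (C : codedType) (x y z : C -> nat * seq nat)
    (a b c : C -> bool) :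
  computable x -> computable y -> computable z ->
  computable a -> computable b -> computable c ->
  computable (fun p => constraint (x p) (y p) (z p) (a p) (b p) (c p)).
Proof.
move=> rx ry rz ra rb rc; rewrite /constraint /witness.
by computable_tac.
Qed.

Lemma recursive_sat_check : recursive_rel sat_check.
Proof.
suff [g rg gE] : computable (fun p : nat * nat => sat_check p.1 p.2).
  apply: recursive_ext (recursive_comp1 rg (recursive_comp2 recursive2_pair
    (recursive_proj ord0) (recursive_proj ord_max))) => v.
  exact: (gE (tnth v ord0, tnth v ord_max)).
rewrite /sat_check /coherent /start.
by computable_tac; apply: computable_constraint; computable_tac.
Qed.

(** * Compactness of the propositional constraints *)

Lemma bitsP m (V : nat -> bool) :
  exists2 w, w < 2 ^ m & forall i, i < m -> bit w i = V i.
Proof.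
elim: m V => [|m IH] V; first by exists 0.
have [w ltw wV] := IH (fun i => V i.+1).
exists (V 0 + w.*2) => [|[|i]].
- rewrite expnS mul2n; move: ltw; rewrite -ltn_double.
  case: (V 0) => //=; rewrite add1n => lt.
  by rewrite -doubleS leq_double -ltn_double.
- by rewrite /bit /= oddD odd_double oddb addbF.
- by rewrite ltnS => /wV; rewrite /bit iterSr half_bit_double.
Qed.

Lemma coherentP n m V :
  reflect ((forall x y z, x < m -> y < m -> z < m ->
             constraint (decode x) (decode y) (decode z) (V x) (V y) (V z)) /\
           (start n < m -> V (start n)))
          (coherent n m V).
Proof.
apply: (iffP andP) => -[cV sV]; split; try exact/implyP.
  move=> x y z xm ym zm; move/allP/(_ x): cV; rewrite mem_iota => /(_ xm).
  move/allP/(_ y); rewrite mem_iota => /(_ ym).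
  by move/allP/(_ z); rewrite mem_iota => /(_ zm).
apply/allP => x; rewrite mem_iota => xm; apply/allP => y; rewrite mem_iota => ym.
by apply/allP => z; rewrite mem_iota => zm; apply: cV.
Qed.

Lemma coherent_sub n m m' (V W : nat -> bool) :
  m' <= m -> (forall i, i < m' -> V i = W i) -> coherent n m V -> coherent n m' W.
Proof.
move=> le VW /coherentP[cV sV]; apply/coherentP; split=> [x y z xm ym zm|sm].
  by rewrite -!VW //; apply: cV; apply: leq_trans le.
by rewrite -VW //; apply: sV; apply: leq_trans le.
Qed.

(** König's lemma for the binary tree. The branch stays on prefixes that extend to a solution at
    every level, taking [true] whenever that keeps this property. *)
Lemma konig (P : nat -> (nat -> bool) -> Prop) :
  (forall m m' V W, m' <= m -> (forall i, i < m' -> V i = W i) -> P m V -> P m' W) ->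
  (forall m, exists V, P m V) -> exists V, forall m, P m V.
Proof.
move=> Psub Pex.
pose ext (s : seq bool) :=
  forall m, exists2 V, P m V & forall i, i < size s -> V i = nth false s i.
pose next s := rcons s `[< ext (rcons s true) >].
have ext_next s : ext s -> ext (next s).
  rewrite /next; case: asboolP => // nt es m.
  apply: contrapT => nf; apply: nt => m1.
  (* One solution at the larger level serves both purposes: if its value after [s] were [false], it
     would be the extension excluded at level [m]; so it is [true] and can be used at level [m1]. *)
  have [V PV Vs] := es (maxn m m1).
  have Pm k : k <= maxn m m1 -> P k V by move=> le; apply: Psub PV.
  exists V; first by apply: Pm; rewrite leq_maxr.
  move=> i; rewrite size_rcons ltnS nth_rcons leq_eqVlt => /orP[/eqP ->|lt].
    rewrite ltnn eqxx; apply/negP => /negP/negbTE Vf; apply: nf.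
    exists V; first by apply: Pm; rewrite leq_maxl.
    move=> j; rewrite size_rcons ltnS nth_rcons leq_eqVlt => /orP[/eqP ->|lt].
      by rewrite ltnn eqxx.
    by rewrite lt Vs.
  by rewrite lt Vs.
pose pre n := iter n next [::].
have ext_pre n : ext (pre n).
  elim: n => [m|n /ext_next //]; by have [V PV] := Pex m; exists V.
have size_pre n : size (pre n) = n by elim: n => //= n IH; rewrite size_rcons IH.
have nth_pre n i : i < n -> nth false (pre n) i = nth false (pre i.+1) i.
  elim: n => // n IH; rewrite ltnS leq_eqVlt => /orP[/eqP -> //|lt].
  by rewrite [pre n.+1]/= nth_rcons size_pre lt IH.
exists (fun i => nth false (pre i.+1) i) => m.
have [V PV Vp] := ext_pre m m; apply: Psub PV => // i im.
by rewrite Vp ?size_pre // nth_pre.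
Qed.

Lemma sat_checkP n : (forall m, sat_check n m) <->
  0 < arity_code n /\ exists V, forall m, coherent n m V.
Proof.
split=> [chk|[n0 [V cV]] m].
  split; first by have /andP[] := chk 0.
  apply: konig => [m m' V W|m]; first exact: coherent_sub.
  by have /andP[_ /hasP[w _ cw]] := chk m; exists (bit w).
rewrite /sat_check n0; apply/hasP; have [w ltw wV] := bitsP m V.
exists w; first by rewrite mem_iota.
by apply: coherent_sub (cV m) => // i im; rewrite wV.
Qed.

(** * From a model to a coherent valuation *)

Arguments arity_code : simpl never.
Arguments decode : simpl never.
Arguments code : simpl never.

Lemma term_code_inv T t u : term_code T = pair_code t u ->
  match T with
  | TRel k i => t == 0
  | TPerm U => (t == 1) && (u == term_code U)
  | TIdent U => (t == 2) && (u == term_code U)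
  | TNeg U => (t == 3) && (u == term_code U)
  | TJoin U W => (t == 4) && (u == pair_code (term_code U) (term_code W))
  | TExists U => (t == 5) && (u == term_code U)
  end.
Proof.
by case: T => [k i|U|U|U|U W|U] /pair_code_inj[<-] => [_|<-|<-|<-|<-|<-];
  rewrite ?eqxx.
Qed.

Lemma iff_eqb (a b : bool) (P Q : Prop) :
  (a <-> P) -> (b <-> Q) -> (P <-> Q) -> a = b.
Proof.
case: a b => -[] [aP Pa] [bQ Qb] [PQ QP] //; first exact/esym/Qb/PQ/aP.
exact/Pa/QP/bQ.
Qed.

Section Skolem.
Variables (M : model) (a0 : dom M) (c : seq (dom M)).

(** A choice of witnesses, uniform in the code of the existential term; [a0] is the default where
    there is no witness. *)
Definition skolem (u : nat) (s : seq (dom M)) : dom M :=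
  if pselect (exists a T, term_code (TExists T) = u /\ holds T (rcons s a)) is left e
  then projT1 (cid e) else a0.

Lemma skolemP T s a : holds T (rcons s a) ->
  holds T (rcons s (skolem (term_code (TExists T)) s)).
Proof.
move=> Ta; rewrite /skolem; case: pselect => [e|[]]; last by exists a, T.
by have [U [/term_code_inj[->]]] := projT2 (cid e).
Qed.

(** Interprets numbers in the given model: even ones as entries of the satisfying tuple [c], odd
    ones as Skolem values. The tuple inside an odd number has smaller entries, so fuel above [x]
    suffices. *)
Fixpoint name_rec (fuel x : nat) : dom M :=
  if fuel is f.+1 then
    if odd x then
      skolem (decode x./2).1 (map (name_rec f) (decode x./2).2)
    else nth a0 c x./2
  else a0.

Definition name (x : nat) : dom M := name_rec x.+1 x.

Lemma mem_decode x a : a \in (decode x).2 -> a < x.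
Proof.
move/mem_leq_code/leq_trans; apply.
rewrite -{2}(code_decode x).
by case/andP: (leq_pair_code (decode x).1 (code (decode x).2)).
Qed.

Lemma name_recE f x : x < f -> name_rec f x = name x.
Proof.
suff H g : x < f -> x < g -> name_rec f x = name_rec g x by move=> /H; apply.
elim: f g x => // f IH [//|g] x /=; rewrite !ltnS => xf xg.
case: ifP => // _; congr skolem; apply/eq_in_map => a /mem_decode ax.
by apply: IH; [apply: leq_trans xf|apply: leq_trans xg];
  apply: leq_trans ax _; rewrite -divn2 leq_div.
Qed.

Lemma name_recS f x : name_rec f.+1 x =
  if odd x then skolem (decode x./2).1 (map (name_rec f) (decode x./2).2)
  else nth a0 c x./2.
Proof. by []. Qed.

Lemma name_const i : name (i + i) = nth a0 c i.
Proof. by rewrite /name /= addnn odd_double doubleK. Qed.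

Lemma name_witness u s : name (witness (u, s)) = skolem u (map name s).
Proof.
rewrite /witness; move E: (code _) => k; rewrite {1}/name name_recS.
rewrite addnn oddS odd_double [_./2]uphalf_double -E decode_code; congr skolem.
apply/eq_in_map => a as_.
rewrite name_recE // ltnS -addnn E.
have ak : a < k by rewrite -E mem_decode // decode_code.
by apply: leq_trans (leq_addl _ _); apply: ltnW.
Qed.

Definition valuation (x : nat) : bool :=
  `[< exists2 T, term_code T = (decode x).1 & holds T (map name (decode x).2) >].

Lemma valuationP T s : valuation (code (term_code T, s)) <-> holds T (map name s).
Proof.
rewrite /valuation decode_code /=; split=> [/asboolP[U /term_code_inj ->]|h] //.
by apply/asboolP; exists T.
Qed.

(** Each clause of [constraint] transcribes the meaning of one operator, pulled back along [name].
    Only the clause asserting a witness relies on the choice of names, through [name_witness]. *)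
Lemma constraint_valuation x y z :
  constraint x y z (valuation (code x)) (valuation (code y)) (valuation (code z)).
Proof.
case: x y z => [u s] [u1 s1] [u2 s2].
move Eb: (valuation (code (u1, s1))) => b.
move Ec: (valuation (code (u2, s2))) => d.
apply/implyP => /eqP /= arx; have [|T eT] := @arity_code_gt0 u; first by rewrite arx.
subst u; move: arx; rewrite arity_term => -[arT].
have sz : size (map name s) = ar T by rewrite size_map.
have := valuationP T s; move: (valuation (code (term_code T, s))) => a aP.
have bP U : u1 = term_code U -> b <-> holds U (map name s1).
  by rewrite -Eb => ->; apply: valuationP.
have dP U : u2 = term_code U -> d <-> holds U (map name s2).
  by rewrite -Ec => ->; apply: valuationP.
move: {Eb Ec} sz aP; rewrite /= -!andbA => sz aP.
(* The seven cases follow the order of the clauses: permutation, identification, negation, join,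
   projection of a nullary term, and the two directions of a proper projection. *)
repeat (apply/andP; split); apply/implyP.
- case/andP=> /eqP/term_code_inv; case: T arT sz aP => //= T arT sz aP /eqP/bP {}bP.
  move/eqP=> es; apply/eqP; apply: (iff_eqb aP bP).
  by rewrite holds_perm // -es map_rot.
- case/andP=> /eqP/term_code_inv; case: T arT sz aP => //= T arT sz aP /eqP eu1 /eqP.
  move/bP: (eu1); rewrite eu1 arity_term ltnS => {}bP es1.
  apply/eqP; apply: (iff_eqb aP bP); rewrite es1; case: ifP => arT1.
    by rewrite holds_ident_small.
  move: arT1; rewrite leqNgt => /negbFE arT1.
  case/lastP: s arT sz {es1 aP} => [|s e] arT sz.
    by case: (ar T) arT1 arT => [|[|k]].
  by rewrite last_rcons !map_rcons holds_ident.
- case/andP=> /eqP/term_code_inv; case: T arT sz aP => //= T arT sz aP /eqP/bP [bT Tb].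
  move/eqP=> es; move: bT Tb aP; rewrite es => bT Tb [aT Ta].
  have [TnT nTT] := holds_neg sz.
  case: b {bP} bT Tb => bT Tb; case: a aT Ta => aT Ta //.
    by case: (TnT (aT isT) (bT isT)).
  by have: false by apply/Ta/nTT => /Tb.
- case/and3P=> /eqP/term_code_inv; case: T arT sz aP => //= T U arT sz aP /eqP.
  case/pair_code_inj => eT eU; rewrite eT arity_term eqSS => /eqP aT1 /eqP es.
  have sz1 : size (map name s1) = ar T by rewrite size_map.
  move: aP; rewrite es map_cat => aP.
  have joinE := holds_join _ _ sz1.
  apply/eqP; apply/idP/andP => [/aP/joinE[/(bP _ eT) ? /(dP _ eU) ?] //|].
  by case=> /(bP _ eT) hT /(dP _ eU) hU; apply/aP/joinE.
- case/and3P=> /eqP/term_code_inv; case: T arT sz aP => //= T arT sz aP /eqP eu1.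
  move/bP: (eu1); rewrite eu1 arity_term ltnS leqn0 => {}bP /eqP arT0 /eqP es.
  by apply/eqP; apply: (iff_eqb aP bP); rewrite es holds_ex0.
- case/and4P=> /eqP/term_code_inv; case: T arT sz aP => //= T arT sz aP /eqP eu1.
  move/bP: (eu1); rewrite eu1 arity_term ltnS => {}bP arT0 /eqP es1.
  move=> /aP/(holds_ex _ arT0)[e Te]; apply/bP.
  by rewrite es1 map_rcons name_witness; apply: skolemP Te.
- case/and4P=> /eqP/term_code_inv; case: T arT sz aP => //= T arT sz aP /eqP eu1.
  move/bP: (eu1); rewrite eu1 arity_term ltnS => {}bP arT0 /eqP es1 /bP.
  rewrite es1 map_rcons => Te.
  by apply/aP/holds_ex => //; eexists; apply: Te.
Qed.

End Skolem.

Lemma coherent_of_sat T : satisfiable T ->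
  exists V, forall m, coherent (term_code T) m V.
Proof.
case/satisfiableP => M [c Tc]; have [a0] := dom_nonempty M.
exists (valuation a0 c) => m; apply/coherentP; split=> [x y z _ _ _|_].
  have := constraint_valuation a0 c (decode x) (decode y) (decode z).
  by rewrite !code_decode.
apply/valuationP; rewrite arity_term /=.
suff -> : map (name a0 c) (consts (ar T)) = c by [].
rewrite /consts -map_comp -(holds_size Tc) -/(mkseq _ _) -[RHS](mkseq_nth a0).
by apply: eq_mkseq => i /=; rewrite name_const.
Qed.

(** * From a coherent valuation to a model on the natural numbers *)

Section Canonical.
Variables (n : nat) (V : nat -> bool).
Hypothesis cV : forall m, coherent n m V.

Definition canonical : model :=
  Model nat (inhabits 0)
    (fun k i t => V (code (term_code (TRel k i), tval t))).

Lemma constraintV x y z : constraint x y z (V (code x)) (V (code y)) (V (code z)).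
Proof.
(* This bound exceeds all three codes, so the finite part contains the constraint. *)
have [cst _] := coherentP _ _ _ (cV (code x + code y + code z).+1).
have := cst (code x) (code y) (code z); rewrite !decode_code; apply.
- by rewrite ltnS -addnA leq_addr.
- by rewrite ltnS addnAC leq_addl.
- by rewrite ltnS leq_addl.
Qed.

(** The truth lemma, by induction on the term: each operator needs the clause of [constraint] for
    it, at suitable tuples. The pair [(0, [::])] fills the third place wherever the operator is
    unary. *)
Lemma canonicalP T (s : seq nat) : size s = ar T ->
  @holds canonical T s <-> V (code (term_code T, s)).
Proof.
elim: T s => [k i|T IH|T IH|T IH|T IHT U IHU|T IH] s sz.
- by move/eqP: sz => sz; apply: (inrelE (interp canonical k i) (Tuple sz)).
- have := constraintV (term_code (TPerm T), s) (term_code T, rot 1 s) (0, [::]).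
  move/implyP; rewrite arity_term sz eqxx => /(_ isT)/andP[/implyP h _].
  rewrite holds_perm // IH ?size_rot //.
  by have /eqP -> := h (introT andP (conj (eqxx _) (eqxx _))).
- pose s1 := if ar T <= 1 then s else rcons s (last 0 s).
  have := constraintV (term_code (TIdent T), s) (term_code T, s1) (0, [::]).
  move/implyP; rewrite !arity_term sz eqxx => /(_ isT)/andP[_ /andP[/implyP h _]].
  have /eqP -> : V (code (term_code (TIdent T), s)) == V (code (term_code T, s1)).
    by apply: h; rewrite /= ?arity_term !eqxx.
  rewrite /s1; case: leqP => arT.
    by rewrite holds_ident_small // IH // sz /=; case: (ar T) arT => [|[]].
  case/lastP: s sz {s1 h} => [|s a] sz.
    by move: sz => /=; case: (ar T) arT => [|[|k]].
  rewrite last_rcons holds_ident // IH // size_rcons sz /=.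
  by case: (ar T) arT => [|[]].
- have := constraintV (term_code (TNeg T), s) (term_code T, s) (0, [::]).
  move/implyP; rewrite !arity_term sz eqxx => /(_ isT)/and4P[_ _ /implyP h _].
  have /eqP -> : V (code (term_code (TNeg T), s)) == ~~ V (code (term_code T, s)).
    by apply: h; rewrite /= !eqxx.
  by rewrite holds_neg // IH //; split=> /negP.
- pose s1 := take (ar T) s; pose s2 := drop (ar T) s.
  have sz1 : size s1 = ar T by rewrite size_takel // sz leq_addr.
  have sz2 : size s2 = ar U by rewrite size_drop sz /= addKn.
  have := constraintV (term_code (TJoin T U), s) (term_code T, s1) (term_code U, s2).
  move/implyP; rewrite !arity_term sz eqxx => /(_ isT)/and5P[_ _ _ /implyP h _].
  have /eqP -> : V (code (term_code (TJoin T U), s)) ==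
      V (code (term_code T, s1)) && V (code (term_code U, s2)).
    by apply: h; rewrite /= ?arity_term sz1 cat_take_drop !eqxx.
  rewrite -{1}(cat_take_drop (ar T) s) holds_join // IHT // IHU //.
  by split=> /andP.
- pose s1 := if ar T <= 0 then s else rcons s (last 0 s).
  case: (posnP (ar T)) => arT.
    have := constraintV (term_code (TExists T), s) (term_code T, s) (0, [::]).
    move/implyP; rewrite !arity_term sz eqxx => /(_ isT).
    case/and5P=> _ _ _ _ /andP[/implyP h _].
    have /eqP -> : V (code (term_code (TExists T), s)) == V (code (term_code T, s)).
      by apply: h; rewrite /= ?arity_term arT !eqxx.
    by rewrite holds_ex0 // IH // sz /= arT.
  have szr a : size (rcons s a) = ar T by rewrite size_rcons sz /= prednK.
  rewrite holds_ex //; split=> [[a]|Vs].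
    have := constraintV (term_code (TExists T), s) (term_code T, rcons s a) (0, [::]).
    move/implyP; rewrite !arity_term sz eqxx => /(_ isT).
    case/and5P=> _ _ _ _ /and3P[_ _ /implyP h]; rewrite IH // => VT; apply: h.
    by rewrite VT /= ?arity_term last_rcons !ltnS arT !eqxx.
  (* The number reserved for this term and tuple is the witness; the other direction above holds for
     an arbitrary number [a]. *)
  pose w := witness (term_code (TExists T), s); exists w; rewrite IH //.
  have := constraintV (term_code (TExists T), s) (term_code T, rcons s w) (0, [::]).
  move/implyP; rewrite !arity_term sz eqxx => /(_ isT).
  case/and5P=> _ _ _ _ /and3P[_ /implyP h _]; apply: h.
  by rewrite Vs /= ?arity_term !ltnS arT !eqxx.
Qed.

End Canonical.

Lemma sat_of_coherent T V : (forall m, coherent (term_code T) m V) -> satisfiable T.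
Proof.
move=> cV; apply/satisfiableP; exists (canonical V), (consts (ar T)).
apply/(canonicalP cV); first by rewrite size_map size_iota.
have [_ h] := coherentP _ _ _ (cV (start (term_code T)).+1).
by have := h (ltnSn _); rewrite /start arity_term.
Qed.

Lemma Pi01_sat_problem : Pi01 sat_problem.
Proof.
exists sat_check; first exact: recursive_sat_check.
move=> n; rewrite sat_checkP; split.
  by case=> T satT <-; rewrite arity_term; split=> //; apply: coherent_of_sat.
by case=> /arity_code_gt0[T <-] [V cV]; exists T => //; apply: sat_of_coherent cV.
Qed.

(** * Relation algebra inside the term language *)

(* Binary relations; [PRec] and [PMu] are relation symbols whose meaning is fixed
   by the axioms below, and an element that has a number as its value is thought of
   as a list with that number as its head. *)
Inductive prog : Type :=
  | PTop | PZero | PSucc | PHead | PTail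
  | PConv (p : prog)
  | PComp (p q : prog)
  | PCap (p q : prog)
  | PRec (p q : prog)
  | PMu (p : prog).

Fixpoint prog_code (p : prog) : nat :=
  match p with
  | PTop => pair_code 0 0
  | PZero => pair_code 1 0
  | PSucc => pair_code 2 0
  | PHead => pair_code 3 0
  | PTail => pair_code 4 0
  | PConv p => pair_code 5 (prog_code p)
  | PComp p q => pair_code 6 (pair_code (prog_code p) (prog_code q))
  | PCap p q => pair_code 7 (pair_code (prog_code p) (prog_code q))
  | PRec p q => pair_code 8 (pair_code (prog_code p) (prog_code q))
  | PMu p => pair_code 9 (prog_code p)
  end.

Lemma prog_code_inj : injective prog_code.
Proof.
elim=> [|||||p IHp|p IHp q IHq|p IHp q IHq|p IHp q IHq|p IHp]
  [|||||p'|p' q'|p' q'|p' q'|p'] /pair_code_inj[] // _.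
- by move/IHp => ->.
- by case/pair_code_inj => /IHp -> /IHq ->.
- by case/pair_code_inj => /IHp -> /IHq ->.
- by case/pair_code_inj => /IHp -> /IHq ->.
- by move/IHp => ->.
Qed.

(* From [R(x,y), S(y',z)], the join is [(x,y,y',z)], rotated to [(z,x,y,y')], where
   [y] and [y'] are identified. *)
Definition comp_term (R S : term) : term :=
  TPerm (TExists (TIdent (TPerm (TJoin R S)))).

(* From [R(x,y), S(x',y')], the join with the converse of [R] is [(y,x,x',y')]; [x]
   and [x'], and likewise [y] and [y'], are cyclically adjacent. *)
Definition cap_term (R S : term) : term :=
  TIdent (TPerm (TIdent (TPerm (TJoin (TPerm R) S)))).

Definition empty_term (R : term) : term := TNeg (TExists (TExists R)).

(** The index of a symbol is the code of the whole program, so different instances of [PRec] and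
    [PMu] receive different symbols. *)
Fixpoint rel (p : prog) : term :=
  match p with
  | PConv p => TPerm (rel p)
  | PComp p q => comp_term (rel p) (rel q)
  | PCap p q => cap_term (rel p) (rel q)
  | _ => TRel 2 (prog_code p)
  end.

Definition incl (p q : prog) : term :=
  empty_term (cap_term (rel p) (TNeg (rel q))).

Lemma ar_rel p : ar (rel p) = 2.
Proof. by elim: p => //= p -> // q ->. Qed.

Section Binary.
Variable M : model.
Implicit Types (R S T : term) (x y z : dom M).

Definition bin (p : prog) x y : Prop := holds (rel p) [:: x; y].

Lemma holds_comp R S x z : ar R = 2 -> ar S = 2 ->
  holds (comp_term R S) [:: x; z] <->
  exists2 y, holds R [:: x; y] & holds S [:: y; z].
Proof.
move=> aR aS; rewrite holds_perm /= ?aR ?aS // holds_ex /= ?aR ?aS //.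
have E y : holds (TIdent (TPerm (TJoin R S))) [:: z; x; y] <->
    holds R [:: x; y] /\ holds S [:: y; z].
  rewrite -[[:: z; x; y]]/(rcons [:: z; x] y) holds_ident /= ?aR ?aS //.
  rewrite holds_perm /= ?aR ?aS // -[rot _ _]/([:: x; y] ++ [:: y; z]).
  by rewrite holds_join.
by split=> [[y /E[]]|[y Rxy Syz]]; exists y => //; apply/E.
Qed.

Lemma holds_cap R S x y : ar R = 2 -> ar S = 2 ->
  holds (cap_term R S) [:: x; y] <-> holds R [:: x; y] /\ holds S [:: x; y].
Proof.
move=> aR aS; rewrite -[[:: x; y]]/(rcons [:: x] y).
rewrite holds_ident /= ?aR ?aS // holds_perm /= ?aR ?aS //.
rewrite -[rot _ _]/(rcons [:: y; y] x) holds_ident /= ?aR ?aS //.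
rewrite holds_perm /= ?aR ?aS // -[rot _ _]/([:: y; x] ++ [:: x; y]).
by rewrite holds_join /= ?aR // holds_perm ?aR.
Qed.

Lemma holds_empty R : ar R = 2 ->
  holds (M := M) (empty_term R) [::] <-> forall x y, ~ holds R [:: x; y].
Proof.
move=> aR; rewrite holds_neg /= ?aR // holds_ex /= ?aR //.
split=> [h x y Rxy|h [x]]; last by rewrite holds_ex ?aR // => -[y]; apply: h.
by apply: h; exists x; rewrite holds_ex ?aR //; exists y.
Qed.

Lemma holds_nil_join T U : ar T = 0 ->
  holds (M := M) (TJoin T U) [::] <->
  holds (M := M) T [::] /\ holds (M := M) U [::].
Proof. by move=> aT; rewrite -[[::]]/([::] ++ [::]) holds_join. Qed.

Lemma bin_conv p x y : bin (PConv p) x y <-> bin p y x.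
Proof. by rewrite /bin /= holds_perm ?ar_rel. Qed.

Lemma bin_comp p q x z : bin (PComp p q) x z <-> exists2 y, bin p x y & bin q y z.
Proof. by apply: holds_comp; apply: ar_rel. Qed.

Lemma bin_cap p q x y : bin (PCap p q) x y <-> bin p x y /\ bin q x y.
Proof. by apply: holds_cap; apply: ar_rel. Qed.

Lemma holds_incl p q : holds (M := M) (incl p q) [::] <->
  forall x y, bin p x y -> bin q x y.
Proof.
have aq : ar (TNeg (rel q)) = 2 by apply: ar_rel.
rewrite holds_empty; last by rewrite /= !ar_rel.
split=> h x y => [pxy|]; last first.
  by rewrite holds_cap ?ar_rel // holds_neg ?ar_rel // => -[/h].
apply: contrapT => nq; apply: (h x y); rewrite holds_cap ?ar_rel //.
by rewrite holds_neg ?ar_rel.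
Qed.

End Binary.

(** * Horn axioms for lists and recursive functions *)

(** In first-order notation the four axioms read: $\exists x\forall y\,Zero(x,y)$; $\forall x\exists
    y\,Succ(x,y)$; $\forall x\forall y\exists z\,(Head(z,x)\wedge Tail(z,y))$; $\forall x\forall
    y\,Top(x,y)$. Zero is a property of the first coordinate. *)
Definition zero_axiom : term := TExists (TNeg (TExists (TNeg (rel PZero)))).
Definition succ_axiom : term := TNeg (TExists (TNeg (TExists (rel PSucc)))).
Definition cons_axiom : term := empty_term (TNeg (rel (PComp (PConv PHead) PTail))).
Definition top_axiom : term := empty_term (TNeg (rel PTop)).
Definition base_axioms : term :=
  TJoin (TJoin zero_axiom succ_axiom) (TJoin cons_axiom top_axiom).

Definition same_tail : prog := PComp PTail (PConv PTail).

Definition rec_base (p : prog) : prog := PCap (PComp PHead PZero) (PComp PTail p).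

(* Relates [a.+1 :: v] to [a :: v]. *)
Definition rec_pred : prog :=
  PCap (PComp (PComp PHead (PConv PSucc)) (PConv PHead)) same_tail.

(* Relates [a.+1 :: v] to [r :: v], where [x] has value [r] at [a :: v]. *)
Definition rec_value (x : prog) : prog :=
  PCap (PComp (PComp rec_pred x) (PConv PHead)) same_tail.

(* Relates [a.+1 :: v] to [[:: a, r & v]]. *)
Definition rec_args (x : prog) : prog :=
  PCap (PComp (PComp rec_pred PHead) (PConv PHead)) (PComp (rec_value x) (PConv PTail)).

Definition rec_step (q x : prog) : prog := PComp (rec_args x) q.

(* [PMu p] relates [v] to [y :: v] if [p] is nonzero at [z :: v] for all [z < y]. *)
Definition mu_base : prog := PCap (PConv PTail) (PComp (PConv PZero) (PConv PHead)).

(** A nonzero value is expressed positively, as a successor of something, by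
    [PComp (PConv PSucc) PTop]; the step from one candidate to the next thus remains a Horn
    clause. *)
Definition mu_step (p x : prog) : prog :=
  PCap (PConv PTail)
    (PComp x (PCap (PComp p (PComp (PConv PSucc) PTop))
                   (PComp PHead (PComp PSucc (PConv PHead))))).

(** Selects a candidate at which [p] vanishes and returns its head. *)
Definition mu_value (p : prog) : prog :=
  PComp (PMu p) (PCap (PComp p PZero) PHead).

(** The symbols [PRec] and [PMu] are bounded only from below. Derivable values are thereby forced in
    every model, while the standard model supplies the converse. For atoms, [top_axiom], already
    among the base axioms, fills the place. *)
Fixpoint axioms (p : prog) : term :=
  match p with
  | PConv p => axioms p
  | PComp p q | PCap p q => TJoin (axioms p) (axioms q)
  | PRec p q =>
      TJoin (TJoin (axioms p) (axioms q))
        (TJoin (incl (rec_base p) (PRec p q)) (incl (rec_step q (PRec p q)) (PRec p q)))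
  | PMu p =>
      TJoin (axioms p)
        (TJoin (incl mu_base (PMu p)) (incl (mu_step p (PMu p)) (PMu p)))
  | _ => top_axiom
  end.

Lemma ar_incl p q : ar (incl p q) = 0.
Proof. by rewrite /= !ar_rel. Qed.

Lemma ar_axioms p : ar (axioms p) = 0.
Proof. by elim: p => //= [p -> q ->|p -> q ->|p -> q ->|p ->] //; rewrite ?ar_rel. Qed.

(** * The standard model *)

Fixpoint rec_rel (F G : seq nat -> seq nat -> Prop) n v y : Prop :=
  if n is m.+1 then
    exists2 r, rec_rel F G m v r & G [:: m, head 0 r & v] y
  else F v y.

(** A number is represented by any list with that head, and by the default of [head] the empty list
    also represents [0]. Values are therefore compared only through their heads. *)
Fixpoint eval (p : prog) (x y : seq nat) : Prop :=
  match p with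
  | PTop => True
  | PZero => head 0 x = 0
  | PSucc => head 0 y = (head 0 x).+1
  | PHead => x <> [::] /\ head 0 y = head 0 x
  | PTail => x <> [::] /\ y = behead x
  | PConv p => eval p y x
  | PComp p q => exists2 z, eval p x z & eval q z y
  | PCap p q => eval p x y /\ eval q x y
  | PRec p q => rec_rel (eval p) (eval q) (head 0 x) (behead x) y
  | PMu p => behead y = x /\
      forall z, z < head 0 y -> exists2 t, eval p (z :: x) t & head 0 t <> 0
  end.

(** The program is recovered from the index of the symbol by [prog_code_inj]; symbols of an arity
    other than [2] are empty. *)
Definition standard : model :=
  Model (seq nat) (inhabits [::])
    (fun k i t => exists x y p, [/\ tval t = [:: x; y], prog_code p = i & eval p x y]).

Lemma standard_bin p (x y : seq nat) : bin (M := standard) p x y <-> eval p x y.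
Proof.
have atom r (u v : seq nat) : rel r = TRel 2 (prog_code r) ->
    bin (M := standard) r u v <-> eval r u v.
  rewrite /bin => ->; rewrite -[[:: u; v]]/(tval [tuple u; v]).
  apply: iff_trans (inrelE (interp standard 2 (prog_code r)) _) _.
  split=> [[x' [y' [r' [[<- <-] /prog_code_inj ->]]]] //|ev].
  by exists u, v, r.
elim: p x y => [|||||p IH|p IHp q IHq|p IHp q IHq|p _ q _|p _] x y;
  try exact: atom.
- by rewrite bin_conv IH.
- by rewrite bin_comp; split=> -[z] /IHp ? /IHq ?; exists z.
- by rewrite bin_cap IHp IHq.
Qed.

Lemma standard_base : holds (M := standard) base_axioms [::].
Proof.
have aT (T : term) : ar T = 2 -> ar (TNeg T) = 2 by [].
rewrite holds_nil_join // !holds_nil_join // !holds_empty //.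
split; split.
- rewrite holds_ex //; exists [::]; rewrite holds_neg // holds_ex // => -[y].
  rewrite holds_neg //; apply; exact/(standard_bin PZero).
- rewrite holds_neg // holds_ex // => -[x]; rewrite holds_neg //; apply.
  rewrite holds_ex //; exists [:: (head 0 x).+1]; exact/(standard_bin PSucc).
- move=> x y; rewrite holds_neg //; apply.
  by apply/(standard_bin (PComp (PConv PHead) PTail)); exists (head 0 x :: y).
- move=> x y; rewrite holds_neg //; apply.
  exact/(standard_bin PTop).
Qed.

Lemma standard_incl p q : (forall x y, eval p x y -> eval q x y) ->
  holds (M := standard) (incl p q) [::].
Proof. by move=> h; apply/holds_incl => x y /standard_bin/h/standard_bin. Qed.

Lemma eval_same_tail x y : eval same_tail x y ->
  [/\ x <> [::], y <> [::] & behead x = behead y].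
Proof. by case=> z [nx ->] [ny]. Qed.

Lemma eval_rec_pred x y : eval rec_pred x y ->
  exists a v, x = a.+1 :: v /\ y = a :: v.
Proof.
case=> -[b [a [nx ea] eb] [ny ey]] /eval_same_tail[_ _].
case: x nx ea => // x0 x _ /= ea; case: y ny ey => // y0 y _ /= ey ->.
by exists y0, y; rewrite -ea eb ey.
Qed.

Lemma eval_rec_value X x u : eval (rec_value X) x u -> exists a v b, [/\ x = a.+1 :: v,
  u = b :: v & exists2 r, eval X (a :: v) r & head 0 r = b].
Proof.
case=> -[r [y /eval_rec_pred[a [v [-> ->]]] Xr] [nu eu]] /eval_same_tail[_ _ /= ev].
by case: u nu eu ev => // u0 u _ /= eu <-; exists a, v, u0; split=> //; exists r.
Qed.

Lemma eval_rec_args X x w : eval (rec_args X) x w -> exists a v r,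
  [/\ x = a.+1 :: v, w = [:: a, head 0 r & v] & eval X (a :: v) r].
Proof.
case=> -[b [y /eval_rec_pred[a [v [-> ->]]] [_ /= eb]] [nw ew]].
case=> u /eval_rec_value[a' [v' [c [[<- <-] -> [r Xr er]]]]] [_ etl].
case: w nw ew etl => // w0 w _ /= ew <-; exists a, v, r.
by rewrite -ew eb er.
Qed.

Lemma standard_axioms p : holds (M := standard) (axioms p) [::].
Proof.
have top : holds (M := standard) top_axiom [::].
  by have /holds_nil_join[//|_ /holds_nil_join[|]] := standard_base.
elim: p => //= [p IHp q IHq|p IHp q IHq|p IHp q IHq|p IHp].
- by rewrite holds_nil_join ?ar_axioms.
- by rewrite holds_nil_join ?ar_axioms.
- rewrite !holds_nil_join ?ar_incl /= ?ar_axioms //; split=> //.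
  split; apply: standard_incl => x y.
    case=> -[a [nx ea] /= a0] [v [_ ->] pv]; case: x nx ea pv => // x0 x _ /=.
    by rewrite a0 => <-.
  by case=> w /(@eval_rec_args (PRec p q))[a [v [r [-> -> Xr]]]] qw; exists r.
- rewrite !holds_nil_join ?ar_incl /= ?ar_axioms //; split=> //.
  split; apply: standard_incl => x y.
    by case=> -[ny ->] [a /= a0 [_ e]]; split=> // z; rewrite -e a0.
  case=> -[ny ->] [s [es below] [[t pt [t0 /= et _]] [a [ns ea] [b eb [_ eb']]]]].
  (* The head of [y] is one more than that of [s]. A smaller [z] is either the head of [s], where
     [p] has just been found nonzero, or lies below it and is covered by [below]. *)
  split=> // z; rewrite -eb' eb ea ltnS leq_eqVlt => /orP[/eqP ->|/below //].
  exists t; last by rewrite et.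
  by rewrite -es; case: s ns pt {es below ea}.
Qed.

(** * Values forced in an arbitrary model *)

(** Only positive facts are recorded: [e] may identify different numbers, and [PSucc], [PHead] and
    [PTail] may be multivalued. *)
Record arithmetic (M : model) (e : nat -> dom M) : Prop := Arithmetic {
  arith_zero : forall y, bin PZero (e 0) y;
  arith_succ : forall n, bin PSucc (e n) (e n.+1);
  arith_cons : forall x y : dom M, exists2 z : dom M, bin PHead z x & bin PTail z y;
  arith_top : forall x y : dom M, bin PTop x y
}.

Lemma base_arithmetic (M : model) :
  holds (M := M) base_axioms [::] -> exists e, @arithmetic M e.
Proof.
rewrite holds_nil_join // !holds_nil_join // !holds_empty //.
rewrite holds_ex // => -[[[z /holds_neg h0] hS] [hC hT]].
have z0 (y : dom M) : bin PZero z y.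
  apply: contrapT => nz; apply: h0 => //; rewrite holds_ex //; exists y.
  by rewrite holds_neg.
have sc (x : dom M) : exists y, bin PSucc x y.
  apply: contrapT => ns; move/holds_neg: hS; apply => //; rewrite holds_ex //.
  exists x; rewrite holds_neg // holds_ex // => -[y Sxy]; apply: ns.
have [f fS] := choice sc; exists (fun n => iter n f z); split=> // [x y|x y].
  have := hC x y; rewrite holds_neg // => /contrapT.
  by move/(bin_comp (PConv PHead) PTail) => [w /bin_conv]; exists w.
by have := hT x y; rewrite holds_neg // => /contrapT.
Qed.

Section Forced.
Variables (M : model) (e : nat -> dom M).

(** Every element represents the empty list, so [represents c s] describes only an initial part of
    [c], and one element may represent many lists. *)
Inductive represents : dom M -> seq nat -> Prop :=
  | represents_nil (c : dom M) : represents c [::]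
  | represents_cons (c d : dom M) n s : bin PHead c (e n) -> bin PTail c d ->
      represents d s -> represents c (n :: s).

Lemma represents_consP c n s : represents c (n :: s) ->
  bin PHead c (e n) /\ exists2 d : dom M, bin PTail c d & represents d s.
Proof.
move E: (n :: s) => t r; case: r E => // {}c d m t' ch ct rd [-> ->].
by split=> //; exists d.
Qed.

Lemma bin_same_tail (c c' d : dom M) :
  bin PTail c d -> bin PTail c' d -> bin same_tail c c'.
Proof. by move=> h h'; apply/bin_comp; exists d; rewrite ?bin_conv. Qed.

Hypothesis ar_e : arithmetic e.

Lemma represents_ex n d s : represents d s ->
  exists c : dom M, [/\ bin PHead c (e n), bin PTail c d & represents c (n :: s)].
Proof.
by move=> rd; have [c ch ct] := arith_cons ar_e (e n) d; exists c; split=> //;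
  apply: represents_cons ch ct rd.
Qed.

Lemma forced_rec_pred (c c' d : dom M) n :
  bin PHead c (e n.+1) -> bin PHead c' (e n) ->
  bin PTail c d -> bin PTail c' d -> bin rec_pred c c'.
Proof.
move=> ch ch' ct ct'; apply/bin_cap; split; last exact: bin_same_tail ct ct'.
apply/bin_comp; exists (e n); last exact/bin_conv.
apply/bin_comp; exists (e n.+1) => //; apply/bin_conv; exact: (arith_succ ar_e).
Qed.

Lemma forced_rec_args X (c c' u w d : dom M) n r :
  bin rec_pred c c' -> bin X c' (e r) -> bin PHead c' (e n) -> bin PTail c d ->
  bin PHead u (e r) -> bin PTail u d -> bin PHead w (e n) -> bin PTail w u ->
  bin (rec_args X) c w.
Proof.
move=> cc' Xr c'h ct uh ut wh wt; apply/bin_cap; split.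
  apply/bin_comp; exists (e n); last exact/bin_conv.
  by apply/bin_comp; exists c'.
apply/bin_comp; exists u; last exact/bin_conv.
apply/bin_cap; split; last exact: bin_same_tail ct ut.
apply/bin_comp; exists (e r); last exact/bin_conv.
by apply/bin_comp; exists c'.
Qed.

End Forced.

(** * Programs for all recursive functions *)

Definition prefix_tuple n (s : seq nat) : n.-tuple nat := [tuple nth 0 s i | i < n].

Lemma prefix_tuple_cons n a s :
  prefix_tuple n.+1 (a :: s) = [tuple of a :: prefix_tuple n s].
Proof.
apply: eq_from_tnth => i; rewrite tnth_mktuple (tnth_nth 0) /=.
case: i => -[|i] ilt //=; rewrite -[RHS]/(nth 0 (tval (prefix_tuple n s)) i).
by rewrite -(tnth_nth 0 (prefix_tuple n s) (Ordinal (ilt : i < n))) tnth_mktuple.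
Qed.

(* The second half says that the value is derivable from the axioms alone; it is
   stated for the names [e n] of the numbers in an arbitrary model. *)
Definition computes n (f : n.-tuple nat -> nat) (p : prog) : Prop :=
  (forall s y, n <= size s -> eval p s y <-> head 0 y = f (prefix_tuple n s)) /\
  (forall M e, @arithmetic M e -> holds (M := M) (axioms p) [::] ->
   forall c s, represents e c s -> n <= size s -> bin p c (e (f (prefix_tuple n s)))).

Lemma computes_zero : computes (fun _ : 0.-tuple nat => 0) (PConv PZero).
Proof.
split=> [s y _ //|M e ar_e _ c s _ _].
by apply/bin_conv; exact: (arith_zero ar_e).
Qed.

Lemma computes_succ :
  computes (fun v : 1.-tuple nat => (tnth v ord0).+1) (PComp PHead PSucc).
Proof.
split=> [[//|a s] y _|M e ar_e _ c [//|a s] /represents_consP[ch _] _];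
  rewrite tnth_mktuple /=.
  split=> [[z [_ ->]] //|->]; by exists [:: a].
by apply/bin_comp; exists (e a) => //; exact: (arith_succ ar_e).
Qed.

Fixpoint proj_prog (i : nat) : prog :=
  if i is j.+1 then PComp PTail (proj_prog j) else PHead.

Lemma computes_proj n (i : 'I_n) :
  computes (fun v : n.-tuple nat => tnth v i) (proj_prog i).
Proof.
split=> [s y ns|M e ar_e _ c s rs ns]; rewrite tnth_mktuple.
  have := leq_trans (ltn_ord i) ns; elim: (nat_of_ord i) s {ns} => [|j IH] [|a s] //=.
    by move=> _; split=> // -[].
  rewrite ltnS => /IH <-; split=> [[z [_ ->]] //|ev]; by exists s.
have := leq_trans (ltn_ord i) ns.
elim: (nat_of_ord i) s c rs {ns} =>
  [|j IH] [|a s] //= c /represents_consP[ch [d ct rd]].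
  by [].
by rewrite ltnS => js; apply/bin_comp; exists d => //; apply: IH.
Qed.

(** The inner functions of a composition are collected into one list by induction on [j]: one
    conjunct fixes the head and the other the tail. Since [PTop] starts the construction, the list
    is arbitrary beyond its first [j] entries. *)
Lemma computes_tuple n j (g : nat -> n.-tuple nat -> nat) :
  (forall i, i < j -> exists p, computes (g i) p) -> exists q,
  [/\ forall s w, n <= size s -> eval q s w ->
        forall i, i < j -> nth 0 w i = g i (prefix_tuple n s),
      forall s, n <= size s -> exists w, eval q s w,
      forall s w, n <= size s -> eval q s w -> j <= size w
    & forall M e, @arithmetic M e -> holds (M := M) (axioms q) [::] ->
      forall c s, represents e c s -> n <= size s ->
      exists2 d, bin q c d &
        represents e d (mkseq (fun i => g i (prefix_tuple n s)) j)].
Proof.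
elim: j g => [|j IH] g gP.
  exists PTop; split=> // [s|M e ar_e _ c s _ _]; first by exists [::].
  by exists c; [exact: (arith_top ar_e)|exact: represents_nil].
have [p [pev pfo]] := gP 0 isT.
have [|q [qnth qex qsz qfo]] := IH (fun i => g i.+1).
  by move=> i; apply: (gP i.+1).
exists (PCap (PComp p (PConv PHead)) (PComp q (PConv PTail))).
have inv s w : n <= size s ->
    eval (PCap (PComp p (PConv PHead)) (PComp q (PConv PTail))) s w ->
    exists2 w', eval q s w' & w = g 0 (prefix_tuple n s) :: w'.
  move=> ns [[a /(pev _ _ ns) ea [nw /= eh]] [w' qw [_ et]]].
  by exists w' => //; case: w nw eh et => // w0 w1 _ /= <- ->; rewrite ea.
split.
- move=> s w ns /(inv _ _ ns)[w' qw ->] [|i] //= ij.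
  exact: qnth qw _ ij.
- move=> s ns; have [w qw] := qex s ns.
  exists (g 0 (prefix_tuple n s) :: w); split; last by exists w.
  by exists [:: g 0 (prefix_tuple n s)] => //; apply/pev.
- by move=> s w ns /(inv _ _ ns)[w' /(qsz _ _ ns) h ->].
move=> M e ar_e; rewrite /= !holds_nil_join /= ?ar_axioms // => -[[axp _] [axq _]].
move=> c s rc ns; have [d qd rd] := qfo M e ar_e axq c s rc ns.
have [d' [dh dt rd']] := represents_ex ar_e (g 0 (prefix_tuple n s)) rd.
exists d'; last first.
  rewrite /mkseq /= -[1]addn0 iotaDl -map_comp.
  exact: rd'.
apply/bin_cap; split; apply/bin_comp.
  by exists (e (g 0 (prefix_tuple n s))); [apply: pfo rc ns|apply/bin_conv].
by exists d => //; apply/bin_conv.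
Qed.

Lemma computes_comp m n (f : m.-tuple nat -> nat) (g : 'I_m -> n.-tuple nat -> nat) p :
  computes f p -> (forall i, exists q, computes (g i) q) ->
  exists q, computes (fun v => f [tuple g i v | i < m]) q.
Proof.
move=> [pev pfo] gP.
(* Extending the family by [0] to all natural indices permits the shift of indices in
   [computes_tuple]. *)
pose g' i v := if insub i is Some i' then g i' v else 0.
have g'E (i : 'I_m) v : g' i v = g i v by rewrite /g' valK.
have [i im|q [qnth qex qsz qfo]] := @computes_tuple n m g'.
  have [q qP] := gP (Ordinal im); exists q.
  by rewrite (_ : g' i = g (Ordinal im)) //; apply/funext => v; rewrite -g'E.
have E w s : (forall i, i < m -> nth 0 w i = g' i (prefix_tuple n s)) ->
    prefix_tuple m w = [tuple g i (prefix_tuple n s) | i < m].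
  by move=> wn; apply: eq_from_tnth => i; rewrite !tnth_mktuple wn // g'E.
exists (PComp q p); split=> [s y ns|M e ar_e ax c s rc ns].
  split=> [[w qw]|hy].
    by move/pev => -> //; [rewrite (E _ s) //; apply: qnth qw|apply: qsz qw].
  have [w qw] := qex s ns; exists w => //; apply/pev; first exact: qsz qw.
  by rewrite (E _ s) //; apply: qnth qw.
move: ax => /holds_nil_join; rewrite /= ar_axioms => -[//|axq axp].
have [d qd rd] := qfo M e ar_e axq c s rc ns.
apply/bin_comp; exists d => //; rewrite -(E (mkseq (g'^~ (prefix_tuple n s)) m)).
  by apply: pfo rd _ => //; rewrite size_mkseq.
by move=> i im; rewrite nth_mkseq.
Qed.

(** Both halves go by induction on the head of the argument. In an arbitrary model the inclusion
    axioms are applied once per stage, to lists supplied by [represents_ex]. *)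
Lemma computes_rec n (f : n.-tuple nat -> nat) (g : n.+2.-tuple nat -> nat)
    (h : n.+1.-tuple nat -> nat) p q :
  computes f p -> computes g q ->
  (forall v : n.-tuple nat, h [tuple of 0 :: v] = f v) ->
  (forall (x : nat) (v : n.-tuple nat), h [tuple of x.+1 :: v] =
     g [tuple of x :: h [tuple of x :: v] :: v]) ->
  computes h (PRec p q).
Proof.
move=> [pev pfo] [qev qfo] h0 hS; split=> [[//|a s] y|M e ar_e].
  rewrite [size _]/= ltnS => ns; rewrite prefix_tuple_cons [eval _ _ _]/=.
  elim: a y => [|a IH] y /=; first by rewrite h0 pev.
  have hr r : rec_rel (eval p) (eval q) a s r ->
      eval q [:: a, head 0 r & s] y <->
      head 0 y = h [tuple of a.+1 :: prefix_tuple n s].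
    by move/IH => ->; rewrite qev // !prefix_tuple_cons hS.
  split=> [[r Xr /(hr _ Xr)] //|hy].
  have Xr : rec_rel (eval p) (eval q) a s [:: h [tuple of a :: prefix_tuple n s]].
    exact/IH.
  by eexists; [exact: Xr|apply/hr].
rewrite /= !holds_nil_join ?ar_incl /= ?ar_axioms //.
move=> -[[axp axq] [/holds_incl base /holds_incl step]] c [//|a s] rc.
rewrite [size _]/= ltnS => ns; rewrite prefix_tuple_cons.
elim: a c rc => [|a IH] c /represents_consP[ch [d ct rd]].
  rewrite h0; apply: base; apply/bin_cap; split; apply/bin_comp.
    by exists (e 0) => //; exact: (arith_zero ar_e).
  by exists d => //; apply: pfo rd ns.
(* The lists required by [rec_args] are [c'] for [a :: s], [u] for [r :: s] and [w] for
   [[:: a, r & s]]. *)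
have [c' [c'h c't rc']] := represents_ex ar_e a rd.
set r := h [tuple of a :: prefix_tuple n s] in IH *.
have [u [uh ut ru]] := represents_ex ar_e r rd.
have [w [wh wt rw]] := represents_ex ar_e a ru.
apply: step; apply/bin_comp; exists w.
  have cc' := forced_rec_pred ar_e ch c'h ct c't.
  exact: forced_rec_args cc' (IH c' rc') c'h ct uh ut wh wt.
have := qfo M e ar_e axq w _ rw ns.
by rewrite !prefix_tuple_cons hS.
Qed.

Lemma computes_mu n (f : n.+1.-tuple nat -> nat) (h : n.-tuple nat -> nat) p :
  computes f p ->
  (forall v : n.-tuple nat, f [tuple of h v :: v] = 0) ->
  (forall (v : n.-tuple nat) (y : nat), y < h v -> f [tuple of y :: v] <> 0) ->
  computes h (mu_value p).
Proof.
move=> [pev pfo] fh fy; split=> [s y ns|M e ar_e].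
  have pz z t : eval p (z :: s) t <-> head 0 t = f [tuple of z :: prefix_tuple n s].
    by rewrite pev ?prefix_tuple_cons.
  split=> [[w [ew below] [[t pt /= t0] [nw ->]]]|hy].
    case: w nw ew below pt => // a w _ /= -> below /pz; rewrite t0 => fa.
    (* A candidate below the minimum is not a zero of [f]; one above it would need [p] to be nonzero
       at the minimum. *)
    case: (ltngtP a (h (prefix_tuple n s))) => // [/fy|ha]; first by rewrite -fa.
    by have [t' /pz -> []] := below _ ha.
  exists (h (prefix_tuple n s) :: s).
    split=> // z /= zh; exists [:: f [tuple of z :: prefix_tuple n s]]; first exact/pz.
    exact: fy.
  split; last by [].
  by exists [:: 0] => //; apply/pz; rewrite fh.
rewrite /= !holds_nil_join ?ar_incl /= ?ar_axioms ?ar_rel //.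
move=> -[[axp [/holds_incl base /holds_incl step]] _].
move=> c s rc ns; set v := prefix_tuple n s.
have pz w z : represents e w (z :: s) -> bin p w (e (f [tuple of z :: v])).
  by move=> rw; have := pfo M e ar_e axp w _ rw ns; rewrite prefix_tuple_cons.
(* All candidates up to the minimum are reached: at each earlier one the forced value of [p] is
   nonzero, hence has the name of its predecessor as a [PSucc]-predecessor. *)
have K z : z <= h v -> exists w, [/\ bin PHead w (e z), bin PTail w c,
    represents e w (z :: s) & bin (PMu p) c w].
  elim: z => [_|z IH zh].
    have [w [wh wt rw]] := represents_ex ar_e 0 rc; exists w; split=> //.
    apply: base; apply/bin_cap; split; first exact/bin_conv.
    by apply/bin_comp; exists (e 0); apply/bin_conv => //; exact: (arith_zero ar_e).
  have [w [wh wt rw]] := represents_ex ar_e z.+1 rc; exists w; split=> //.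
  have [w' [w'h w't rw' Kw']] := IH (ltnW zh).
  apply: step; apply/bin_cap; split; first exact/bin_conv.
  apply/bin_comp; exists w' => //; apply/bin_cap; split; apply/bin_comp.
    exists (e (f [tuple of z :: v])); first exact: pz.
    apply/bin_comp; exists (e (f [tuple of z :: v]).-1); last exact: (arith_top ar_e).
    apply/bin_conv; have := fy v z zh.
    by case: (f _) => // k _; exact: (arith_succ ar_e).
  exists (e z) => //; apply/bin_comp; exists (e z.+1); first exact: (arith_succ ar_e).
  exact/bin_conv.
have [w [wh wt rw Kw]] := K _ (leqnn _).
apply/bin_comp; exists w => //; apply/bin_cap; split=> //.
apply/bin_comp; exists (e 0); last exact: (arith_zero ar_e).
by rewrite -(fh v); apply: pz.
Qed.

Lemma recursive_computes n (f : n.-tuple nat -> nat) :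
  recursive f -> exists p, computes f p.
Proof.
elim=> {n f} [||n i|m n f g _ [p pP] _ gP|n f g h _ [p pP] _ [q qP] h0 hS
  |n f h _ [p pP] fh fy].
- by exists (PConv PZero); apply: computes_zero.
- by exists (PComp PHead PSucc); apply: computes_succ.
- by exists (proj_prog i); apply: computes_proj.
- exact: computes_comp pP gP.
- by exists (PRec p q); apply: computes_rec pP qP h0 hS.
- by exists (mu_value p); apply: computes_mu pP fh fy.
Qed.

(** * The reduction *)

Fixpoint numeral (n : nat) : prog :=
  if n is m.+1 then PComp (numeral m) PSucc else PConv PZero.

(* Relates any element to any other one if [p] is zero at some list starting with
   [n] and having at least two entries. *)
Definition query (p : prog) (n : nat) : prog :=
  PComp (PComp (PComp (numeral n)
    (PCap (PConv PHead) (PComp PTop (PConv (PComp PTail PHead))))) p) PZero.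

Definition reduction (p : prog) (n : nat) : term :=
  TJoin base_axioms (TJoin (axioms p) (empty_term (rel (query p n)))).

Lemma eval_numeral n x y : eval (numeral n) x y <-> head 0 y = n.
Proof.
elim: n x y => //= n IH x y; split=> [[z /IH <-] //|->].
by exists [:: n] => //; apply/IH.
Qed.

Lemma forced_numeral M e n x : @arithmetic M e -> bin (numeral n) x (e n).
Proof.
move=> ar_e; elim: n => [|n IH]; first exact/bin_conv/(arith_zero ar_e).
by apply/bin_comp; exists (e n) => //; apply: (arith_succ ar_e).
Qed.

Lemma holds_reduction M p n : holds (M := M) (reduction p n) [::] <->
  [/\ holds (M := M) base_axioms [::], holds (M := M) (axioms p) [::]
    & forall x y : dom M, ~ bin (query p n) x y].
Proof.
rewrite holds_nil_join // holds_nil_join ?ar_axioms // holds_empty ?ar_rel //.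
by split=> [[? []]|[]].
Qed.

Lemma prefix_tuple2 a b s : prefix_tuple 2 [:: a, b & s] = [tuple a; b].
Proof.
by apply: eq_from_tnth => i; rewrite tnth_mktuple (tnth_nth 0); case: i => -[|[]].
Qed.

(** A zero of [r] makes the query nonempty in every model of the axioms. If there is none, the
    standard model is a model of the whole term, since there the query finds only genuine zeros. *)
Lemma reductionP (r : 2.-tuple nat -> nat) p n : computes r p ->
  satisfiable (reduction p n) <-> forall m, r [tuple n; m] <> 0.
Proof.
move=> [pev pfo]; rewrite satisfiableP; split=> [[M [s]] hs m r0|rn].
  have s0 : s = [::].
    by apply: size0nil; rewrite (holds_size hs) /= !ar_rel ar_axioms.
  subst s; case/holds_reduction: hs => /base_arithmetic[e ar_e] axp noq.
  have [d [dh dt rd]] := represents_ex ar_e m (represents_nil e (e 0)).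
  have [c [ch ct rc]] := represents_ex ar_e n rd.
  apply: (noq (e 0) (e 0)); apply/bin_comp; exists (e 0); last exact: (arith_zero ar_e).
  apply/bin_comp; exists c; last first.
    by have := pfo M e ar_e axp c _ rc isT; rewrite prefix_tuple2 r0.
  apply/bin_comp; exists (e n); first exact: forced_numeral.
  apply/bin_cap; split; first exact/bin_conv.
  apply/bin_comp; exists (e m); first exact: (arith_top ar_e).
  by apply/bin_conv/bin_comp; exists d.
exists standard, [::]; apply/holds_reduction; split.
- exact: standard_base.
- exact: standard_axioms.
move=> x y /standard_bin[t [d [a /eval_numeral an [hd tl]] pd] /= t0].
case: hd tl => nd ad [b _ [d' [_ dd'] [nd' _]]].
(* The tail of [d] has a head, so [d] has the two entries that [computes] requires of an argument
   list. *)
case: d nd ad pd dd' => // d0 [|d1 d] _ /= ad pd dd'; first by [].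
move/(pev [:: d0, d1 & d] _ isT): pd; rewrite prefix_tuple2 t0 -ad an => /esym.
exact: rn.
Qed.

(** * Recursiveness of the reduction *)

Section ComputableTerm.
Variable C : codedType.
Implicit Types F G : C -> term.

Definition computable_term F : Prop := computable (fun c => term_code (F c)).

Lemma computable_term_const T : computable_term (fun=> T).
Proof. exact: computable_const. Qed.

Lemma computable_join F G : computable_term F -> computable_term G ->
  computable_term (fun c => TJoin (F c) (G c)).
Proof.
move=> rF rG; apply: (@computable_pair_code _ (fun=> 4)); first exact: computable_const.
exact: computable_pair_code.
Qed.

Lemma computable_comp_term F G : computable_term F -> computable_term G ->
  computable_term (fun c => comp_term (F c) (G c)).
Proof.
move=> rF rG; do 4 (apply: (@computable_pair_code _ (fun=> _));
  first exact: computable_const).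
exact: computable_join.
Qed.

Lemma computable_empty_term F : computable_term F ->
  computable_term (fun c => empty_term (F c)).
Proof.
move=> rF; do 3 (apply: (@computable_pair_code _ (fun=> _));
  first exact: computable_const).
exact: rF.
Qed.

End ComputableTerm.

Lemma computable_numeral : computable_term (fun n : nat => rel (numeral n)).
Proof.
(* The numbers are the tags of the constructors in [comp_term], from the outermost [TPerm] to
   [TJoin]. *)
pose step r := pair_code 1 (pair_code 5 (pair_code 2 (pair_code 1
  (pair_code 4 (pair_code r (term_code (rel PSucc))))))).
apply: (@computable_ext _ _ (fun n : nat =>
    iteri n (fun _ => step) (term_code (rel (numeral 0))))).
  by elim=> // n IH; rewrite [LHS]/= IH.
apply: computable_iteri; [exact: computable_id| |exact: computable_const].
by rewrite /step; computable_tac.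
Qed.

(** Only the numeral inside the query depends on [n]; the remaining subterms have constant codes. *)
Lemma recursive_reduction p : recursive_fun (fun n => term_code (reduction p n)).
Proof.
apply: computable_recursive; apply: computable_join; first exact: computable_term_const.
apply: computable_join; first exact: computable_term_const.
apply: computable_empty_term.
do 3 (apply: computable_comp_term; last exact: computable_term_const).
exact: computable_numeral.
Qed.

Theorem theorem6p4 : Pi01_complete sat_problem.
Proof.
split; first exact: Pi01_sat_problem.
move=> Q [R recR QR]; have [p pR] := recursive_computes recR.
exists (fun n => term_code (reduction p n)); first exact: recursive_reduction.
move=> n; rewrite QR; have redP := reductionP n pR.
split=> [Rn|[T satT /term_code_inj eT]].
  exists (reduction p n) => //; apply/redP => m.
  by rewrite !(tnth_nth 0) /= Rn.
move: satT; rewrite eT => /redP h m; have := h m.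
by rewrite !(tnth_nth 0) /=; case: (R n m).
Qed.
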